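(* Let $(\Omega,\mathscr{F},(\mathscr{F}_t)_{t\ge0},P)$ be a filtered probability space satisfying the usual conditions. Suppose $1\le q\le p\le\infty$ and $r\in[1,\infty]$ satisfies $1/r+1/p=1/q$. Let $X\colon\mathbb{R}_+\times\Omega\to\mathbb{C}$ be a stochastic process, and assume that $\sup\{\|X_s\|_{L^r(P)}:0\le s\le t\}<\infty$ for all $t\ge0$. (i) If $X$ has a predictable modification and $p>q$ (i.e., $r\ne\infty$), then $H_X$ is an $\mathbb{M}^{p;q}$-predictable linear process. (ii) If $H_X$ is an $\mathbb{M}^{p;q}$-predictable linear process, then $X$ has a predictable modification.
   Context: Usual conditions: $(\mathscr{F}_t)$ is complete ($\mathscr{F}_0$ contains all subsets of $\Omega$ contained in a $P$-null set of $\mathscr{F}$) and right-continuous. A stochastic process is a map $X\colon\mathbb{R}_+\times\Omega\to\mathbb{C}$ such that each $X_t=X(t,\cdot)$ is $\mathscr{F}$-measurable. $Y$ is a modification of $X$ if $X_t=Y_t$ a.s. for each $t\ge0$. The predictable $\sigma$-algebra on $\mathbb{R}_+\times\Omega$ is generated by $\{\{0\}\times F:F\in\mathscr{F}_0\}\cup\{(s,t]\times F:0\le s<t,\ F\in\mathscr{F}_s\}$; a process is predictable if it is measurable with respect to it. $L^p(P)=L^p(\Omega,\mathscr{F},P)$; $B^{p;q}$ is the space of bounded real-linear maps $L^p(P)\to L^q(P)$ with operator norm $\|\cdot\|_{p;q}$. For $y\in L^r(P)$, $M_y\in B^{p;q}$ is $M_yx=yx$. $H_X\colon\mathbb{R}_+\to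 B^{p;q}$ is $H_X(t)=M_{X_t}$. $\mathcal{M}_t^{p;q}=\{M_y:y\in L^r(\Omega,\mathscr{F}_t,P)\}$, $\mathbb{M}^{p;q}=(\mathcal{M}_t^{p;q})_{t\ge0}$, $\mathcal{M}_\infty^{p;q}=\bigcup_t\mathcal{M}_t^{p;q}$. $\mathbb{M}^{p;q}$-predictable linear processes: an elementary one is $H=1_{\{0\}}T_0+\sum_{i=1}^k1_{(s_i,t_i]}T_i$ with $t_i>s_i\ge0$, $T_i\in\mathcal{M}_{s_i}^{p;q}$ ($s_0:=0$). $H_n\to H$ locally boundedly if $H_n\to H$ pointwise in $\|\cdot\|_{p;q}$ and $\sup_n\sup_{s\le t}\|H_n(s)\|_{p;q}<\infty$ for all $t$. The set $\mathcal{I}_{\mathbb{M}^{p;q}}$ of $\mathbb{M}^{p;q}$-predictable linear processes is the smallest set of locally bounded functions $\mathbb{R}_+\to\mathcal{M}_\infty^{p;q}$ that contains the elementary ones and is closed under (sequential) locally bounded convergence. *)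

(* Defs.v *)
From HB Require Import structures.
From mathcomp Require Import all_boot all_order all_algebra complex.
From mathcomp Require Import all_classical all_reals all_analysis.
From mathcomp Require Import ess_sup_inf measurable_realfun.

Set Implicit Arguments.
Unset Strict Implicit.
Unset Printing Implicit Defensive.

Import Order.TTheory GRing.Theory Num.Theory.
Import numFieldNormedType.Exports.

Local Open Scope classical_set_scope.
Local Open Scope ring_scope.

(* The complex numbers are [Rcomplex R], i.e. [R[i]] regarded as a normed
   algebra over the reals: scaling is by real numbers and the modulus [`|z|]
   takes its values in [R]. *)

Section complex_measurable.
Context {R : realType}.

Definition pair_of_complex (z : Rcomplex R) : R * R := (complex.Re z, complex.Im z).
Definition complex_of_pair (u : R * R) : Rcomplex R := Complex u.1 u.2.

(* The Borel sets of the plane, transported along the identification of the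
   complex numbers with the pairs of real numbers. *)
Definition complex_measurable : set (set (Rcomplex R)) :=
  [set A | measurable (complex_of_pair @^-1` A)].

Let complex_measurable0 : complex_measurable set0.
Proof. by rewrite /complex_measurable/= preimage_set0; exact: measurable0. Qed.

Let complex_measurableC A :
  complex_measurable A -> complex_measurable (~` A).
Proof. by rewrite /complex_measurable/= preimage_setC; exact: measurableC. Qed.

Let complex_measurable_bigcup (A : (set (Rcomplex R))^nat) :
  (forall i, complex_measurable (A i)) -> complex_measurable (\bigcup_i A i).
Proof.
move=> mA; rewrite /complex_measurable/= preimage_bigcup.
by apply: bigcupT_measurable => i; exact: mA.
Qed.

HB.instance Definition _ := isPointed.Build (Rcomplex R) 0.
HB.instance Definition _ := isMeasurable.Build default_measure_display
  (Rcomplex R) complex_measurable0 complex_measurableC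
  complex_measurable_bigcup.

End complex_measurable.

Section complex_measurable_fun.
Context d (T : measurableType d) (R : realType).
Implicit Types f g : T -> Rcomplex R.

Lemma measurable_fun_complexP f :
  measurable_fun setT f <->
  measurable_fun setT (fun x => complex.Re (f x) : R) /\
  measurable_fun setT (fun x => complex.Im (f x) : R).
Proof.
have fE : f = complex_of_pair \o (pair_of_complex \o f).
  by apply/funext => x /=; case: (f x).
transitivity (measurable_fun setT (pair_of_complex \o f)).
  split => [mf _ A mA|mf _ A mA].
    rewrite setTI comp_preimage -[X in measurable X]setTI; apply: mf => //.
    rewrite /measurable/=/complex_measurable/= -comp_preimage.
    rewrite (_ : pair_of_complex \o _ = id) ?preimage_id//.
    by apply/funext => -[].
  rewrite setTI fE comp_preimage -[X in measurable X]setTI.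
  exact: mf.
exact: measurable_fun_pairP.
Qed.

Lemma measurable_complexD f g : measurable_fun setT f ->
  measurable_fun setT g -> measurable_fun setT (f \+ g).
Proof.
move=> /measurable_fun_complexP[rf jf] /measurable_fun_complexP[rg jg].
apply/measurable_fun_complexP; split.
  rewrite (_ : (fun x => _) = (fun x => complex.Re (f x)) \+ (fun x => complex.Re (g x)))//.
    exact: measurable_funD.
  by apply/funext => x /=; case: (f x); case: (g x).
rewrite (_ : (fun x => _) = (fun x => complex.Im (f x)) \+ (fun x => complex.Im (g x)))//.
  exact: measurable_funD.
by apply/funext => x /=; case: (f x); case: (g x).
Qed.

Lemma measurable_complexM f g : measurable_fun setT f ->
  measurable_fun setT g -> measurable_fun setT (f \* g).
Proof.
move=> /measurable_fun_complexP[rf jf] /measurable_fun_complexP[rg jg].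
apply/measurable_fun_complexP; split.
  rewrite (_ : (fun x => _) = ((fun x => complex.Re (f x)) \* (fun x => complex.Re (g x)))
    \- ((fun x => complex.Im (f x)) \* (fun x => complex.Im (g x))))//.
    by apply: measurable_funB; exact: measurable_funM.
  by apply/funext => x /=; case: (f x); case: (g x).
rewrite (_ : (fun x => _) = ((fun x => complex.Re (f x)) \* (fun x => complex.Im (g x)))
  \+ ((fun x => complex.Im (f x)) \* (fun x => complex.Re (g x))))//.
  by apply: measurable_funD; exact: measurable_funM.
by apply/funext => x /=; case: (f x); case: (g x).
Qed.

Lemma measurable_complexZ (a : R) f : measurable_fun setT f ->
  measurable_fun setT (fun x => a *: f x).
Proof.
move=> /measurable_fun_complexP[rf jf].
apply/measurable_fun_complexP; split.
  rewrite (_ : (fun x => _) = (fun x => a * complex.Re (f x)))//.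
    exact: measurable_funM.
  by apply/funext => x /=; case: (f x).
rewrite (_ : (fun x => _) = (fun x => a * complex.Im (f x)))//.
  exact: measurable_funM.
by apply/funext => x /=; case: (f x).
Qed.

Lemma measurable_complexN f : measurable_fun setT f ->
  measurable_fun setT (fun x => - f x).
Proof.
move=> /(measurable_complexZ (-1)); apply: eq_measurable_fun => x _.
by rewrite scaleN1r.
Qed.

Lemma measurable_complex_norm f : measurable_fun setT f ->
  measurable_fun setT (fun x => `|f x| : R).
Proof.
move=> /measurable_fun_complexP[rf jf].
rewrite (_ : (fun x => _) =
    (fun x => Num.sqrt ((complex.Re (f x)) ^+ 2 + (complex.Im (f x)) ^+ 2)))//.
  apply: measurableT_comp => //.
    apply: continuous_measurable_fun; exact: sqrt_continuous.
  by apply: measurable_funD; exact: measurable_funX.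
by apply/funext => x /=; rewrite /Num.norm /=; case: (f x).
Qed.

End complex_measurable_fun.

Section complex_Lnorm.
Context d (T : measurableType d) (R : realType) (P : probability T R).
Implicit Types (f g : T -> Rcomplex R) (p q r : \bar R).
Local Open Scope ereal_scope.

(* The L^p norm of a complex function is that of its modulus. *)
Definition cLnorm p f : \bar R := 'N[P]_p[EFin \o (fun x => `|f x|)%R].

Let P_gt0 : 0 < P [set: T]. Proof. by rewrite probability_setT. Qed.

Lemma cLnorm_ge0 p f : 0 <= cLnorm p f.
Proof. exact: Lnorm_ge0. Qed.

Lemma ae_le_Lnorm p (f g : T -> R) : 1 <= p ->
  measurable_fun setT f -> measurable_fun setT g ->
  (\forall x \ae P, (`|f x| <= `|g x|)%R) ->
  'N[P]_p[EFin \o f] <= 'N[P]_p[EFin \o g].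
Proof.
case: p => [p| |] // p1 mf mg fg; rewrite unlock.
  rewrite lee_fin in p1; have p0 : (0 <= p)%R by exact: le_trans p1.
  have mN (h : T -> R) : measurable_fun setT h ->
      measurable_fun setT (fun x => `|(EFin \o h) x| `^ p).
    move=> mh; apply: (@measurableT_comp _ _ _ _ _ _ (@poweR R ^~ p)).
      exact: measurable_poweR.
    apply/(measurable_EFinP setT (fun x => `|h x|%R)).
    exact: measurableT_comp.
  have bnd (h : T -> R) : \int[P]_x `|(EFin \o h) x| `^ p \in `[0, +oo].
    by rewrite in_itv/= leey andbT integral_ge0// => x _; exact: poweR_ge0.
  apply: gt0_ler_poweR; rewrite ?invr_ge0 ?bnd//.
  apply: ae_ge0_le_integral => //.
  - by move=> x _; exact: poweR_ge0.
  - exact: mN.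
  - by move=> x _; exact: poweR_ge0.
  - exact: mN.
  - apply: filterS fg => x fgx _ /=.
    by rewrite lee_fin ge0_ler_powR// nnegrE.
rewrite P_gt0; apply: le_ess_sup; apply: filterS fg => x /=.
by rewrite lee_fin.
Qed.

Lemma ae_le_cLnorm p f g : 1 <= p ->
  measurable_fun setT f -> measurable_fun setT g ->
  (\forall x \ae P, (`|f x| <= `|g x|)%R) -> cLnorm p f <= cLnorm p g.
Proof.
move=> p1 mf mg fg; apply: ae_le_Lnorm => //; try exact: measurable_complex_norm.
by apply: filterS fg => x; rewrite !normr_id.
Qed.

Lemma ae_eq_cLnorm p f g : 1 <= p ->
  measurable_fun setT f -> measurable_fun setT g ->
  f = g %[ae P] -> cLnorm p f = cLnorm p g.
Proof.
move=> p1 mf mg fg; apply/eqP; rewrite eq_le !ae_le_cLnorm//;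
  by apply: filterS fg => x ->.
Qed.

Lemma cLnorm0 p : 1 <= p -> cLnorm p (cst 0%R) = 0.
Proof.
move=> p1; rewrite /cLnorm (_ : EFin \o _ = cst 0).
  by rewrite Lnorm0// gt_eqF// (lt_le_trans _ p1).
by apply/funext => x /=; rewrite normr0.
Qed.

Lemma LnormZ_fun p (a : R) (f : T -> R) : 1 <= p -> measurable_fun setT f ->
  'N[P]_p[EFin \o (a \*o f)%R] = `|a|%:E * 'N[P]_p[EFin \o f].
Proof.
case: p => [p| |] // p1 mf; rewrite unlock.
  have p0 : (0 < p)%R by rewrite lee_fin in p1; exact: lt_le_trans p1.
  under eq_integral => x _.
    rewrite /= normrM powRM// EFinM.
    over.
  rewrite ge0_integralZl//.
  - rewrite poweRM ?lee_fin ?powR_ge0//; last first.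
      by apply: integral_ge0 => x _; rewrite lee_fin powR_ge0.
    by rewrite poweR_EFin -powRrM mulfV ?gt_eqF// powRr1.
  - apply/measurable_EFinP.
    apply: (@measurableT_comp _ _ _ _ _ _ (@powR R ^~ p)).
      exact: measurable_powR.
    exact: measurableT_comp.
rewrite P_gt0 -ess_supZl//; congr (ess_sup _ _); apply/funext => x /=.
by rewrite normrM EFinM.
Qed.

Lemma cLnormZ p (a : R) f : 1 <= p -> measurable_fun setT f ->
  cLnorm p (fun x => a *: f x)%R = `|a|%:E * cLnorm p f.
Proof.
move=> p1 mf; rewrite /cLnorm -(@LnormZ_fun _ _ (fun x => `|f x|%R))//;
  last exact: measurable_complex_norm.
rewrite -[LHS]Lnorm_abse -[RHS]Lnorm_abse; congr Lnorm; apply/funext => x /=.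
congr EFin; rewrite normrM !normr_id.
case: (f x) => u v; rewrite /Num.norm/= !exprMn -mulrDr sqrtrM ?sqr_ge0//.
by rewrite sqrtr_sqr.
Qed.

Lemma cLnormD p f g : 1 <= p ->
  measurable_fun setT f -> measurable_fun setT g ->
  cLnorm p (f \+ g)%R <= cLnorm p f + cLnorm p g.
Proof.
move=> p1 mf mg.
have mnf := measurable_complex_norm mf; have mng := measurable_complex_norm mg.
apply: le_trans (eminkowski _ mnf mng p1).
apply: ae_le_Lnorm => //.
- exact/measurable_complex_norm/measurable_complexD.
- exact: measurable_funD.
apply: aeW => x /=; rewrite normr_id ger0_norm ?addr_ge0//.
exact: ler_normD.
Qed.

Lemma cLnorm_eq0 p f : 1 <= p -> measurable_fun setT f ->
  cLnorm p f = 0 -> f = cst 0%R %[ae P].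
Proof.
move=> p1 mf /Lnorm_eq0_eq0 f0.
have : (fun x => `|f x|%:E) = \0 %[ae P].
  apply: f0; last exact: lt_le_trans p1.
  exact/measurable_EFinP/measurable_complex_norm.
by apply: filterS => x fx0 _ /=; apply/eqP; rewrite -normr_eq0 -eqe fx0.
Qed.

Lemma normcM_real (z w : Rcomplex R) :
  (`|(z * w : Rcomplex R)| = `|z| * `|w|)%R.
Proof. exact: Normc.normcM. Qed.

Lemma cLnorm_esssup f : cLnorm +oo f < +oo ->
  \forall x \ae P, (`|f x| <= fine (cLnorm +oo f))%R.
Proof.
move=> foo.
have fE : (fine (cLnorm +oo f))%:E = cLnorm +oo f.
  by rewrite fineK// ge0_fin_numE ?cLnorm_ge0.
have := foo; have : cLnorm +oo f <= cLnorm +oo f by [].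
rewrite {1}/cLnorm {1}unlock P_gt0 => /ess_supP H _.
by apply: filterS H => x /=; rewrite -fE normr_id lee_fin.
Qed.

Lemma cLnorm_hoelder p q r f g : 1 <= p -> 1 <= q -> 1 <= r ->
  r^-1 + p^-1 = q^-1 ->
  measurable_fun setT f -> measurable_fun setT g ->
  cLnorm r f < +oo -> cLnorm p g < +oo ->
  cLnorm q (f \* g)%R <= cLnorm r f * cLnorm p g.
Proof.
move=> p1 q1 r1 pqr mf mg ff fg.
have half (u v : T -> Rcomplex R) : measurable_fun setT u ->
    measurable_fun setT v -> cLnorm +oo u < +oo ->
    cLnorm q (u \* v)%R <= cLnorm +oo u * cLnorm q v.
  move=> mu mv uoo; set M := fine (cLnorm +oo u).
  have M0 : (0 <= M)%R by rewrite fine_ge0// cLnorm_ge0.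
  have -> : cLnorm +oo u = `|M|%:E.
    by rewrite ger0_norm// fineK// ge0_fin_numE// cLnorm_ge0.
  rewrite -cLnormZ//; apply: ae_le_cLnorm => //.
  - exact: measurable_complexM.
  - exact: measurable_complexZ.
  apply: filterS (cLnorm_esssup uoo) => x ux /=.
  rewrite normcM_real.
  have -> : (`|M *: v x| = M * `|v x|)%R.
    case: (v x) => a b; rewrite /Num.norm/= !exprMn -mulrDr sqrtrM ?sqr_ge0//.
    by rewrite sqrtr_sqr ger0_norm.
  by rewrite ler_wpM2r.
case: r r1 pqr ff => [r| |]// r1 pqr ff; last first.
  rewrite invey add0e in pqr; have -> : p = q by rewrite -[p]inveK pqr inveK.
  exact: half.
case: p p1 pqr fg => [p| |]// p1 pqr fg; last first.
  rewrite invey adde0 in pqr.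
  have -> : r%:E = q by rewrite -[r%:E]inveK pqr inveK.
  rewrite muleC (_ : (_ \* _)%R = (g \* f)%R); first exact: half.
  by apply/funext => x /=; rewrite mulrC.
have r0 : (0 < r)%R by rewrite lee_fin in r1; exact: lt_le_trans r1.
have p0 : (0 < p)%R by rewrite lee_fin in p1; exact: lt_le_trans p1.
rewrite !inver !gt_eqF// in pqr.
case: q q1 pqr half => [q| |]// q1 pqr half; last first.
  by move: pqr; rewrite invey -EFinD => -[] /eqP; rewrite gt_eqF// addr_gt0// invr_gt0.
have q0 : (0 < q)%R by rewrite lee_fin in q1; exact: lt_le_trans q1.
rewrite inver gt_eqF// in pqr; move: pqr; rewrite -EFinD => -[pqr].
have mP (h : T -> Rcomplex R) s : measurable_fun setT h ->
    measurable_fun setT (fun x => (`|h x| `^ s)%R).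
  move=> mh; apply: (@measurableT_comp _ _ _ _ _ _ (@powR R ^~ s)).
    exact: measurable_powR.
  exact: measurable_complex_norm.
have := @hoelder _ _ _ P (fun x => `|f x| `^ q)%R (fun x => `|g x| `^ q)%R
  (r / q) (p / q) (mP _ _ mf) (mP _ _ mg) (divr_gt0 r0 q0) (divr_gt0 p0 q0).
rewrite !invf_div -[(q / r)%R]/(q * r^-1)%R -[(q / p)%R]/(q * p^-1)%R.
rewrite -mulrDr pqr mulfV ?gt_eqF// => /(_ erefl) H.
have NE (h : T -> Rcomplex R) s : (0 < s)%R ->
    'N[P]_(s / q)%:E[EFin \o (fun x => `|h x| `^ q)%R] = cLnorm s%:E h `^ q.
  move=> s0; rewrite /cLnorm unlock -poweRrM invf_div [(q / s)%R]mulrC; congr (_ `^ _).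
  apply: eq_integral => x _ /=.
  rewrite ?poweR_EFin ger0_norm ?powR_ge0// -powRrM normr_id.
  by rewrite mulrCA divff ?gt_eqF// mulr1.
have {}H : cLnorm q%:E (f \* g)%R `^ q <= (cLnorm r%:E f * cLnorm p%:E g) `^ q.
  rewrite poweRM ?cLnorm_ge0// -(NE f r)// -(NE g p)//; apply: le_trans H.
  rewrite Lnorm1 /cLnorm poweR_Lnorm ?gt_eqF//.
  rewrite le_eqVlt; apply/orP; left; apply/eqP; apply: eq_integral => x _ /=.
  by rewrite normr_id ?poweR_EFin normcM_real powRM// ger0_norm// mulr_ge0// powR_ge0.
have := @gt0_ler_poweR R q^-1 _ _ _ _ _ H.
rewrite -!poweRrM mulfV ?gt_eqF// !poweRe1 ?mule_ge0 ?cLnorm_ge0//.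
by apply; rewrite ?invr_ge0 ?(ltW q0)// in_itv/= leey andbT poweR_ge0.
Qed.

End complex_Lnorm.

Section L0.
Context d (T : measurableType d) (R : realType) (P : probability T R).

(* Complex random variables modulo almost sure equality. *)
Definition L0 : Type := {mfun_ P, T >-> Rcomplex R}.
HB.instance Definition _ := Choice.on L0.
HB.instance Definition _ := EqQuotient.on L0.

Definition repr0 (x : L0) : T -> Rcomplex R := repr x.

Lemma measurable_repr0 (x : L0) : measurable_fun setT (repr0 x).
Proof. exact: measurable_funPT. Qed.

Section class.
Variables (f : T -> Rcomplex R) (mf : measurable_fun setT f).

Let mfun_of : T -> Rcomplex R := let _ := mf in f.
HB.instance Definition _ :=
  @isMeasurableFun.Build _ _ T (Rcomplex R) mfun_of mf.

Definition class0 : L0 := (\pi_L0 (mfun_of : {mfun T >-> Rcomplex R}))%qT.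

Lemma repr_class0 : repr0 class0 = f %[ae P].
Proof.
have : (\pi_L0 (repr class0) = \pi_L0 (mfun_of : {mfun T >-> Rcomplex R}))%qT.
  exact: reprK.
by move/eqmodP => /asboolP.
Qed.
End class.

Lemma eqL0P (x y : L0) : x = y <-> repr0 x = repr0 y %[ae P].
Proof.
split => [->|xy]; first exact: aeW.
by rewrite -[x]reprK -[y]reprK; apply/eqmodP/asboolP.
Qed.

Definition addL0 (x y : L0) :=
  class0 (measurable_complexD (measurable_repr0 x) (measurable_repr0 y)).
Definition oppL0 (x : L0) := class0 (measurable_complexN (measurable_repr0 x)).
Definition zeroL0 := class0 (@measurable_cst _ _ T (Rcomplex R) setT 0).
Definition scaleL0 (a : R) (x : L0) :=
  class0 (measurable_complexZ a (measurable_repr0 x)).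
Definition mulL0 (x y : L0) :=
  class0 (measurable_complexM (measurable_repr0 x) (measurable_repr0 y)).

Let addL0E x y : repr0 (addL0 x y) = repr0 x \+ repr0 y %[ae P].
Proof. exact: repr_class0. Qed.

Let oppL0E x : repr0 (oppL0 x) = (fun t => - repr0 x t) %[ae P].
Proof. exact: repr_class0. Qed.

Let zeroL0E : repr0 zeroL0 = cst 0 %[ae P].
Proof. exact: repr_class0. Qed.

Let scaleL0E a x : repr0 (scaleL0 a x) = (fun t => a *: repr0 x t) %[ae P].
Proof. exact: repr_class0. Qed.

Let addL0A : associative addL0.
Proof.
move=> x y z; apply/eqL0P.
apply: filterS3 (filterI (addL0E x (addL0 y z)) (addL0E (addL0 x y) z))
  (addL0E y z) (addL0E x y) => t [h1 h2] h3 h4 _.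
by rewrite h1// h2//= h3// h4//= addrA.
Qed.

Let addL0C : commutative addL0.
Proof.
move=> x y; apply/eqL0P.
apply: filterS2 (addL0E x y) (addL0E y x) => t h1 h2 _.
by rewrite h1// h2//= addrC.
Qed.

Let add0L0 : left_id zeroL0 addL0.
Proof.
move=> x; apply/eqL0P.
apply: filterS2 (addL0E zeroL0 x) zeroL0E => t h1 h2 _.
by rewrite h1//= h2//= add0r.
Qed.

Let addNL0 : left_inverse zeroL0 oppL0 addL0.
Proof.
move=> x; apply/eqL0P.
apply: filterS3 (addL0E (oppL0 x) x) zeroL0E (oppL0E x) => t h1 h2 h3 _.
by rewrite h1//= h2//= h3//= addNr.
Qed.

HB.instance Definition _ := GRing.isZmodule.Build L0 addL0A addL0C add0L0 addNL0.

Let scaleL0A a b x : scaleL0 a (scaleL0 b x) = scaleL0 (a * b) x.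
Proof.
apply/eqL0P.
apply: filterS3 (scaleL0E a (scaleL0 b x)) (scaleL0E (a * b) x) (scaleL0E b x)
  => t h1 h2 h3 _.
by rewrite h1//= h2//= h3//= scalerA.
Qed.

Let scale1L0 : left_id 1 scaleL0.
Proof.
move=> x; apply/eqL0P; apply: filterS (scaleL0E 1 x) => t h _.
by rewrite h//= scale1r.
Qed.

Let scaleL0Dr : right_distributive scaleL0 +%R.
Proof.
move=> a x y; apply/eqL0P.
apply: filterS3 (filterI (scaleL0E a (x + y)) (addL0E x y))
  (filterI (scaleL0E a x) (scaleL0E a y))
  (addL0E (scaleL0 a x) (scaleL0 a y)) => t [h1 h2] [h3 h4] h5 _.
by rewrite h1//= h2//= h5//= h3//= h4//= scalerDr.
Qed.

Let scaleL0Dl x : {morph scaleL0^~ x : a b / a + b}.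
Proof.
move=> a b; apply/eqL0P.
apply: filterS3
  (filterI (scaleL0E (a + b) x) (addL0E (scaleL0 a x) (scaleL0 b x)))
  (scaleL0E a x) (scaleL0E b x) => t [h1 h2] h3 h4 _.
by rewrite h1//= h2//= h3//= h4//= scalerDl.
Qed.

HB.instance Definition _ := GRing.Zmodule_isLmodule.Build R L0
  scaleL0A scale1L0 scaleL0Dr scaleL0Dl.

Lemma repr0D (x y : L0) : repr0 (x + y) = repr0 x \+ repr0 y %[ae P].
Proof. exact: addL0E. Qed.

Lemma repr0Z a (x : L0) : repr0 (a *: x) = (fun t => a *: repr0 x t) %[ae P].
Proof. exact: scaleL0E. Qed.

Lemma repr00 : repr0 0 = cst 0 %[ae P].
Proof. exact: zeroL0E. Qed.

Lemma repr0M (x y : L0) : repr0 (mulL0 x y) = repr0 x \* repr0 y %[ae P].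
Proof. exact: repr_class0. Qed.

End L0.

Section Lp.
Context d (T : measurableType d) (R : realType) (P : probability T R).

(* The proof of [1 <= p] is an argument so that the closure properties below
   can be inferred. *)
Definition Lp_pred (p : \bar R) (p1 : (1 <= p)%E) : {pred L0 P} :=
  fun x => (cLnorm P p (repr0 x) < +oo)%E.

Variables (p : \bar R) (p1 : (1 <= p)%E).

(* The complex space L^p, regarded as a real normed space. *)
Record Lp := MkLp { Lp_val :> L0 P; _ : Lp_val \in Lp_pred p1 }.
HB.instance Definition _ := [isSub for Lp_val].
HB.instance Definition _ := [Choice of Lp by <:].

Let Lp_closed : submod_closed (Lp_pred p1).
Proof.
split.
  rewrite unfold_in (ae_eq_cLnorm p1 (measurable_repr0 _) _ (repr00 P)).
    by rewrite cLnorm0.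
  exact: measurable_cst.
move=> a x y; rewrite !unfold_in => xoo yoo.
have mx := measurable_repr0 x; have my := measurable_repr0 y.
have mZx := measurable_complexZ a mx.
rewrite (ae_eq_cLnorm p1 (measurable_repr0 _) (measurable_complexD mZx my)).
- apply: (le_lt_trans (cLnormD P p1 mZx my)).
  by rewrite cLnormZ// lte_add_pinfty// lte_mul_pinfty ?lee_fin.
- apply: filterS2 (repr0D (a *: x) y) (repr0Z a x) => t h1 h2 _.
  by rewrite h1//= h2.
Qed.
HB.instance Definition _ :=
  GRing.isSubmodClosed.Build R (L0 P) (Lp_pred p1) Lp_closed.
HB.instance Definition _ := [SubChoice_isSubLmodule of Lp by <:].

Definition Lp_norm (x : Lp) : R := fine (cLnorm P p (repr0 x)).

Lemma Lp_normE (x : Lp) : (Lp_norm x)%:E = cLnorm P p (repr0 x).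
Proof. by rewrite fineK// ge0_fin_numE ?cLnorm_ge0//; exact: valP x. Qed.

Let Lp_normD x y : Lp_norm (x + y) <= Lp_norm x + Lp_norm y.
Proof.
rewrite -lee_fin EFinD !Lp_normE.
have mx := measurable_repr0 x; have my := measurable_repr0 y.
apply: le_trans (cLnormD P p1 mx my).
rewrite (ae_eq_cLnorm p1 (measurable_repr0 _) _ (repr0D x y))//.
exact: measurable_complexD.
Qed.

Let Lp_normZ a x : Lp_norm (a *: x) = `|a| * Lp_norm x.
Proof.
apply: EFin_inj; rewrite EFinM !Lp_normE -(cLnormZ P a p1 (measurable_repr0 x)).
have mZ := measurable_complexZ a (measurable_repr0 x).
exact: (ae_eq_cLnorm p1 (measurable_repr0 _) mZ (repr0Z a x)).
Qed.

Let Lp_norm0_eq0 x : Lp_norm x = 0 -> x = 0.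
Proof.
move=> x0; apply/val_inj/eqL0P.
have : repr0 x = cst 0 %[ae P].
  apply: (cLnorm_eq0 p1); first exact: measurable_repr0.
  by rewrite -Lp_normE x0.
apply: filterS2 (repr00 P) => t h1 h2 _.
by rewrite h1//= h2.
Qed.

HB.instance Definition _ :=
  Lmodule_isNormed.Build R Lp Lp_normD Lp_normZ Lp_norm0_eq0.

Lemma Lp_valP (x : Lp) : (cLnorm P p (repr0 x) < +oo)%E.
Proof. exact: valP x. Qed.

Section class.
Variables (f : T -> Rcomplex R) (mf : measurable_fun setT f)
  (foo : (cLnorm P p f < +oo)%E).

Let class0_Lp : class0 P mf \in Lp_pred p1.
Proof.
rewrite unfold_in (ae_eq_cLnorm p1 (measurable_repr0 _) mf)//.
exact: repr_class0.
Qed.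

Definition classLp : Lp := MkLp class0_Lp.

Lemma repr_classLp : repr0 classLp = f %[ae P].
Proof. exact: repr_class0. Qed.
End class.

End Lp.

Section bounded_operators.
Context (R : realType) (V W : normedModType R).
Implicit Types T : V -> W.

Definition bounded_op_pred : {pred V -> W} := fun T =>
  `[< linear T /\ exists M : R, forall x, `|T x| <= M * `|x| >].

(* The bounded real-linear operators from V to W. *)
Record Bop := MkBop { Bop_fun :> V -> W; _ : Bop_fun \in bounded_op_pred }.
HB.instance Definition _ := [isSub for Bop_fun].
HB.instance Definition _ := [Choice of Bop by <:].

Let bounded_op_closed : submod_closed bounded_op_pred.
Proof.
split.
  have z x : (0 : V -> W) x = 0 by [].
  rewrite unfold_in; apply/asboolP; split.
    by move=> a x y; rewrite !z scaler0 addr0.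
  by exists 0 => x; rewrite z normr0 mul0r.
move=> a S T; rewrite !unfold_in => /asboolP[lS [M SM]] /asboolP[lT [N TN]].
have e x : (a *: S + T) x = a *: S x + T x by [].
apply/asboolP; split.
  move=> b x y; rewrite !e lS lT !scalerDr addrACA; congr (_ + _ + _).
  by rewrite !scalerA mulrC.
exists (`|a| * M + N) => x; rewrite e mulrDl -mulrA.
by rewrite (le_trans (ler_normD _ _))// lerD// normrZ ler_wpM2l.
Qed.
HB.instance Definition _ :=
  GRing.isSubmodClosed.Build R (V -> W) bounded_op_pred bounded_op_closed.
HB.instance Definition _ := [SubChoice_isSubLmodule of Bop by <:].

Definition opnorm (T : Bop) : R := sup [set `|T x| | x in [set x | `|x| <= 1]].

Lemma Bop_linear (T : Bop) : linear T.
Proof. by have := valP T; rewrite unfold_in => /asboolP[]. Qed.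

Lemma Bop_bounded (T : Bop) : exists M : R, forall x, `|T x| <= M * `|x|.
Proof. by have := valP T; rewrite unfold_in => /asboolP[]. Qed.

Let BopZ (T : Bop) a x : T (a *: x) = a *: T x.
Proof.
have T0 : T 0 = 0.
  have := Bop_linear T 1 0 0; rewrite !scale1r addr0 => /eqP.
  by rewrite -subr_eq0 opprD addNKr oppr_eq0 => /eqP.
by have := Bop_linear T a x 0; rewrite T0 !addr0.
Qed.

Let opnorm_has_sup (T : Bop) :
  has_sup [set `|T x| | x in [set x | `|x| <= 1]].
Proof.
split; first by exists `|T 0|, 0 => //=; rewrite normr0.
have [M TM] := Bop_bounded T; exists `|M| => _ [x /= x1 <-].
rewrite (le_trans (TM x))// (le_trans (ler_wpM2r _ (ler_norm M)))//.
by rewrite ler_piMr.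
Qed.

Let opnorm_ub (T : Bop) x : `|x| <= 1 -> `|T x| <= opnorm T.
Proof. by move=> x1; apply: sup_upper_bound; [exact: opnorm_has_sup|exists x]. Qed.

Lemma opnorm_ge0 (T : Bop) : 0 <= opnorm T.
Proof. by apply: le_trans (opnorm_ub T (_ : `|0| <= 1)) => //; rewrite normr0. Qed.

Lemma opnorm_le (T : Bop) (M : R) :
  (forall x, `|x| <= 1 -> `|T x| <= M) -> opnorm T <= M.
Proof.
move=> TM; apply: ge_sup; first by case: (opnorm_has_sup T).
by move=> _ [x /= x1 <-]; exact: TM.
Qed.

Lemma le_opnorm (T : Bop) x : `|T x| <= opnorm T * `|x|.
Proof.
have [->|x0] := eqVneq x 0.
  by have := BopZ T 0 0; rewrite !scale0r => ->; rewrite !normr0 mulr0.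
have nx : 0 < `|x| by rewrite normr_gt0.
have : `|T (`|x|^-1 *: x)| <= opnorm T.
  by apply: opnorm_ub; rewrite normrZ normfV normr_id mulVf ?gt_eqF.
by rewrite BopZ normrZ normfV normr_id mulrC ler_pdivrMr.
Qed.

Let opnormD (S T : Bop) : opnorm (S + T) <= opnorm S + opnorm T.
Proof.
apply: opnorm_le => x x1.
by rewrite (le_trans (ler_normD (S x) (T x)))// lerD// opnorm_ub.
Qed.

Let opnormZ a (T : Bop) : opnorm (a *: T) = `|a| * opnorm T.
Proof.
have le b (S : Bop) : opnorm (b *: S) <= `|b| * opnorm S.
  apply: opnorm_le => x x1.
  by rewrite (_ : (b *: S) x = b *: S x)// normrZ ler_wpM2l// opnorm_ub.
apply/eqP; rewrite eq_le le/=.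
have [->|a0] := eqVneq a 0; first by rewrite normr0 mul0r opnorm_ge0.
have := le a^-1 (a *: T); rewrite scalerA mulVf// scale1r normfV.
by rewrite mulrC ler_pdivlMr ?normr_gt0// mulrC.
Qed.

Let opnorm0_eq0 (T : Bop) : opnorm T = 0 -> T = 0.
Proof.
move=> T0; apply/val_inj/funext => x; apply/eqP; rewrite -normr_le0.
by rewrite (le_trans (le_opnorm T x))// T0 mul0r.
Qed.

HB.instance Definition _ :=
  Lmodule_isNormed.Build R Bop opnormD opnormZ opnorm0_eq0.

Lemma Bop_normE (T : Bop) : `|T| = opnorm T. Proof. by []. Qed.

End bounded_operators.

Section multiplication_operator.
Context d (T : measurableType d) (R : realType) (P : probability T R).
Context (p q r : \bar R) (p1 : (1 <= p)%E) (q1 : (1 <= q)%E) (r1 : (1 <= r)%E).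
Hypothesis pqr : (r^-1 + p^-1 = q^-1)%E.
Variable y : Lp P r1.

Let mulLp_subproof (x : Lp P p1) : mulL0 (y : L0 P) (x : L0 P) \in Lp_pred q1.
Proof.
have my := measurable_repr0 y; have mx := measurable_repr0 x.
rewrite unfold_in.
rewrite (ae_eq_cLnorm q1 (measurable_repr0 _) (measurable_complexM my mx)).
  apply: (le_lt_trans (cLnorm_hoelder p1 q1 r1 pqr my mx _ _));
    rewrite ?Lp_valP// -!Lp_normE.
  by rewrite -EFinM ltey.
exact: repr0M.
Qed.

(* The product is in L^q by Hoelder's inequality, so no default value is
   needed. *)
Definition mulLp (x : Lp P p1) : Lp P q1 := MkLp (mulLp_subproof x).

Lemma norm_mulLp x : `|mulLp x| <= `|y| * `|x|.
Proof.
have my := measurable_repr0 y; have mx := measurable_repr0 x.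
rewrite -lee_fin EFinM !Lp_normE.
rewrite (ae_eq_cLnorm q1 (measurable_repr0 _) (measurable_complexM my mx)).
  by apply: cLnorm_hoelder => //; exact: Lp_valP.
exact: repr0M.
Qed.

Let mulLp_bounded : mulLp \in @bounded_op_pred R (Lp P p1) (Lp P q1).
Proof.
rewrite unfold_in; apply/asboolP; split; last by exists `|y|; exact: norm_mulLp.
move=> a u v; apply/val_inj/eqL0P.
apply: filterS3 (filterI (repr0M y (a *: u + v)) (repr0D (a *: \val u) (\val v)))
  (filterI (repr0Z a (\val u)) (repr0D (a *: mulL0 y u) (mulL0 y v)))
  (filterI (repr0Z a (mulL0 y u)) (filterI (repr0M y u) (repr0M y v))).
move=> t [h1 h2] [h3 h4] [h5 [h6 h7]] _.
rewrite h4//= h5//= h6//= h7//= h1//= h2//= h3//= mulrDr; congr (_ + _).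
by rewrite [LHS]mulrC -scalerAl [in LHS]mulrC.
Qed.

Definition mulop : Bop (Lp P p1) (Lp P q1) := MkBop mulLp_bounded.

End multiplication_operator.

HB.instance Definition _ (R : realType) := Choice.on {nonneg R}.
HB.instance Definition _ (R : realType) := isPointed.Build {nonneg R} 0%:nng.

Section filtered_space.
Context d (T : measurableType d) (R : realType) (P : probability T R).
Implicit Types (F : {nonneg R} -> set (set T)).
Implicit Types (X Y : {nonneg R} -> T -> Rcomplex R).

Definition filtration F :=
  [/\ forall t, sigma_algebra setT (F t),
      forall t, F t `<=` measurable &
      forall s t, s <= t -> F s `<=` F t].

Definition usual_conditions F :=
  [/\ filtration F,
      P.-negligible `<=` F 0%:nng &
      forall t, \bigcap_(s in [set s | t < s]) F s = F t].

Definition stochastic_process X := forall t, measurable_fun setT (X t).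

Definition predictable_rectangle F : set (set ({nonneg R} * T)) :=
  [set [set 0%:nng] `*` A | A in F 0%:nng] `|`
  [set B | exists s t A,
     [/\ s < t, F s A & B = [set u | s < u <= t] `*` A]].

Definition predictable F X :=
  measurable_fun setT
    (fun u : g_sigma_algebraType (predictable_rectangle F) => X u.1 u.2).

Definition modification Y X := forall t, X t = Y t %[ae P].

Definition has_predictable_modification F X :=
  exists Y, [/\ stochastic_process Y, predictable F Y & modification Y X].

End filtered_space.

Section predictable_linear.
Context (R : realType) (B : normedModType R).
Implicit Types (M : {nonneg R} -> set B) (H : {nonneg R} -> B).

Definition elementary M : set ({nonneg R} -> B) := [set H |
  exists (k : nat) (s t : 'I_k -> {nonneg R}) (T0 : B) (S : 'I_k -> B),
    [/\ forall i, s i < t i, M 0%:nng T0, forall i, M (s i) (S i) &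
        H = fun u => \1_[set 0%:nng] u *: T0 +
                     \sum_(i < k) \1_[set v | s i < v <= t i] u *: S i]].

Definition locally_bounded H :=
  forall t, has_ubound [set `|H s| | s in [set s | s <= t]].

Definition cvg_locally_boundedly (Hn : nat -> {nonneg R} -> B) H :=
  (forall s, Hn n s @[n --> \oo] --> H s) /\
  forall t, has_ubound [set `|Hn u.1 u.2| | u in [set u | u.2 <= t]].

(* The locally bounded functions with values in the union of the M_t. *)
Definition locally_bounded_in M : set ({nonneg R} -> B) :=
  [set H | locally_bounded H /\ forall t, (\bigcup_s M s) (H t)].

(* Closedness is relative to [locally_bounded_in M], the functions among which
   the smallest set is taken. *)
Definition closed_locally_boundedly M (I : set ({nonneg R} -> B)) :=
  forall Hn H, (forall n, I (Hn n)) -> locally_bounded_in M H ->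
    cvg_locally_boundedly Hn H -> I H.

Definition predictable_linear M : set ({nonneg R} -> B) :=
  smallest
    [set I | I `<=` locally_bounded_in M /\ closed_locally_boundedly M I]
    (elementary M).

End predictable_linear.

Section linear_process.
Context d (T : measurableType d) (R : realType) (P : probability T R).
Context (p q r : \bar R) (p1 : (1 <= p)%E) (q1 : (1 <= q)%E) (r1 : (1 <= r)%E).
Hypothesis pqr : (r^-1 + p^-1 = q^-1)%E.
Implicit Types (F : {nonneg R} -> set (set T)).
Implicit Types (X : {nonneg R} -> T -> Rcomplex R).

(* The subspace of the classes having a G-measurable representative. *)
Definition Lp_sub (G : set (set T)) : set (Lp P r1) :=
  [set y | exists2 f : T -> Rcomplex R,
     measurable_fun setT (f : g_sigma_algebraType G -> Rcomplex R) &
     repr0 y = f %[ae P]].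

Definition mulops F (t : {nonneg R}) : set (Bop (Lp P p1) (Lp P q1)) :=
  [set mulop p1 q1 pqr y | y in Lp_sub (F t)].

Definition Lr_locally_bounded X := forall t,
  (ereal_sup [set cLnorm P r (X s) | s in [set s | (s <= t)%R]] < +oo)%E.

Lemma Lr_locally_bounded_fin X : Lr_locally_bounded X ->
  forall t, (cLnorm P r (X t) < +oo)%E.
Proof.
move=> bX t; apply: le_lt_trans (bX t).
by apply: ereal_sup_ubound; exists t => /=.
Qed.

Variables (X : {nonneg R} -> T -> Rcomplex R).
Hypotheses (mX : stochastic_process X) (bX : Lr_locally_bounded X).

Definition linear_process (t : {nonneg R}) : Bop (Lp P p1) (Lp P q1) :=
  mulop p1 q1 pqr (classLp r1 (mX t) (Lr_locally_bounded_fin bX t)).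

End linear_process.

Arguments mulops {d T R} P {p q r} p1 q1 r1 pqr F t.

(* Elementary processes are locally bounded with values in the operators of the
   family, so that [predictable_linear] is an intersection over a nonempty
   collection of sets. *)
Section predictable_linear_wf.
Context (R : realType) (B : normedModType R) (M : {nonneg R} -> set B).
Hypothesis M0 : forall t, M t 0.
Hypothesis MZD : forall t (a : R) x y, M t x -> M t y -> M t (a *: x + y).
Hypothesis M_mono : forall s t, s <= t -> M s `<=` M t.

Lemma elementary_locally_bounded_in : elementary M `<=` locally_bounded_in M.
Proof.
move=> _ [k [s [t [T0 [S [st MT0 MS ->]]]]]].
have nind (A : set {nonneg R}) u (x : B) : `|\1_A u *: x| <= `|x|.
  by rewrite normrZ indicE; case: (_ \in _); rewrite ?normr1 ?normr0 ?mul1r ?mul0r.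
split => u.
  exists (`|T0| + \sum_(i < k) `|S i|) => _ [v _ <-].
  rewrite (le_trans (ler_normD _ _))// lerD//.
  by rewrite (le_trans (ler_norm_sum _ _ _))// ler_sum.
exists u => //.
have MD x y : M u x -> M u y -> M u (x + y).
  by move=> Mx My; rewrite -[x]scale1r; exact: MZD.
have Mind (A : set {nonneg R}) x : (A u -> M u x) -> M u (\1_A u *: x).
  move=> Ax; rewrite indicE; have [/set_mem/Ax|_] := boolP (u \in A).
    by rewrite scale1r.
  by rewrite scale0r.
have MT : M u (\1_[set 0%:nng] u *: T0) by apply: Mind => /= ->.
apply: (MD _ _ MT); apply: (big_ind (M u)) => // i _; apply: Mind => /= /andP[/ltW siu _].
exact: M_mono siu _ (MS i).
Qed.

End predictable_linear_wf.

Section mulops_family.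
Context d (T : measurableType d) (R : realType) (P : probability T R).
Context (p q r : \bar R) (p1 : (1 <= p)%E) (q1 : (1 <= q)%E) (r1 : (1 <= r)%E).
Hypothesis pqr : (r^-1 + p^-1 = q^-1)%E.
Variable F : {nonneg R} -> set (set T).
Hypothesis filtF : filtration F.
Local Notation mulops := (mulops P p1 q1 r1 pqr F).
Local Notation mulop := (mulop p1 q1 pqr).

Lemma mulop_linear (a : R) (y z : Lp P r1) :
  mulop (a *: y + z) = a *: mulop y + mulop z.
Proof.
apply/val_inj/funext => x; apply/val_inj/eqL0P.
apply: filterS3 (filterI (repr0M (a *: y + z) x) (repr0D (a *: \val y) (\val z)))
  (filterI (repr0Z a (\val y)) (repr0D (a *: mulL0 y x) (mulL0 z x)))
  (filterI (repr0Z a (mulL0 y x)) (filterI (repr0M y x) (repr0M z x))).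
move=> t [h1 h2] [h3 h4] [h5 [h6 h7]] _.
by rewrite h1//= h2//= h3//= h4//= h5//= h6//= h7//= mulrDl -scalerAl.
Qed.

Lemma mulops_linear t (a : R) x y : mulops t x -> mulops t y ->
  mulops t (a *: x + y).
Proof.
move=> [u [f mf uf] <-] [v [g mg vg] <-]; exists (a *: u + v); last first.
  exact: mulop_linear.
exists (fun w => a *: f w + g w).
  exact: (measurable_complexD (measurable_complexZ a mf) mg).
apply: filterS3 (filterI uf vg) (repr0D (a *: \val u) (\val v)) (repr0Z a (\val u)).
by move=> w [h1 h2] h3 h4 _; rewrite h3//= h4//= h1//= h2.
Qed.

Lemma mulops0 t : mulops t 0.
Proof.
exists 0; last first.
  by have := mulop_linear (-1) 0 0; rewrite scaleN1r !addNr => ->; rewrite scaleN1r addNr.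
exists (cst 0); last exact: repr00.
exact: (@measurable_cst _ _ (g_sigma_algebraType (F t)) (Rcomplex R)).
Qed.

Lemma mulops_mono s t : s <= t -> mulops s `<=` mulops t.
Proof.
move=> st _ [u [f mf uf] <-]; exists u => //; exists f => // _ A mA.
have [_ _ /(_ _ _ st) Fst] := filtF.
have := mf measurableT A mA; apply: sub_sigma_algebra2 => //.
Qed.

Lemma elementary_mulops : elementary mulops `<=` locally_bounded_in mulops.
Proof.
apply: elementary_locally_bounded_in; first exact: mulops0.
  exact: mulops_linear.
exact: mulops_mono.
Qed.

End mulops_family.

(* Main.v *)
Require Import Defs.
From HB Require Import structures.
From mathcomp Require Import all_boot all_order all_algebra complex.
From mathcomp Require Import all_classical all_reals all_analysis.
From mathcomp Require Import finmap ess_sup_inf measurable_realfun.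

Set Implicit Arguments.
Unset Strict Implicit.
Unset Printing Implicit Defensive.

Import Order.TTheory GRing.Theory Num.Theory.
Import numFieldNormedType.Exports.

Local Open Scope classical_set_scope.
Local Open Scope ring_scope.

(** Write M_y for multiplication by a class y of L^r, and H_Y for the map
    sending t to M_(Y t).

    From predictable processes to predictable linear ones, the argument is a
    functional monotone class theorem. For the indicator of a predictable
    rectangle the process H_Y is elementary. Predictable linear processes form
    a real vector space ([predictable_linear_linear]), and when r is finite the
    dominated convergence theorem shows that H_(Y_n) tends to H_Y in a locally
    bounded way as soon as Y_n tends to Y pointwise and is dominated by Y
    ([mul_predictable_dominated]); this is where p > q enters. Dynkin's theorem
    then covers all predictable sets ([mul_predictable_indicator]), and
    approximation by simple functions covers all predictable processes that are
    locally bounded in L^r ([predictable_mul_predictable]).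

    Conversely, consider the functions H such that, for some predictable Y,
    every H t is multiplication by the class of Y t. They contain the
    elementary processes, and what must be shown is that they are stable under
    locally bounded limits. If M_(Y_n t) tends to M_(h t) in operator norm,
    evaluating at the constant function 1 shows that Y_n t tends to h t in mean.
    For a fixed t a subsequence converges almost surely, but it depends on t.
    By Fubini's theorem the mean distance between Y_m t and Y_l t is measurable
    in t with respect to the sigma-algebra of those sets of times S for which
    the product of S with the whole sample space is predictable; so the
    subsequence can be chosen measurably in t. Along it the processes are
    still predictable, and so is their upper limit ([predictable_limit]).
    Because y is determined by M_y, the process obtained for H_X is a
    modification of X. *)

(** * The predictable sigma-algebra *)

Section predictable_sets.
Context d (T : measurableType d) (R : realType) (P : probability T R).
Variable F : {nonneg R} -> set (set T).
Hypothesis filtF : filtration F.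
Local Notation rect := (predictable_rectangle F).

Lemma filtration_measurable t (A : set T) :
  @measurable _ (g_sigma_algebraType (F t)) A = F t A.
Proof. by have [saF _ _] := filtF; rewrite -[in RHS](sigma_algebra_id (saF t)). Qed.

Lemma filtrationT t : F t setT.
Proof. by rewrite -filtration_measurable; exact: measurableT. Qed.

Lemma filtration0 t : F t set0.
Proof. by rewrite -filtration_measurable; exact: measurable0. Qed.

Lemma filtrationI t A B : F t A -> F t B -> F t (A `&` B).
Proof. by rewrite -!filtration_measurable; exact: measurableI. Qed.

Lemma filtration_mono s t : s <= t -> F s `<=` F t.
Proof. by case: filtF => _ _; exact. Qed.

Lemma predictable_rectangle0 : rect set0.
Proof. by left; exists set0; [exact: filtration0|rewrite setX0]. Qed.

Lemma predictable_rectangleI : setI_closed rect.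
Proof.
move=> _ _ [[A FA <-]|[s [t [A [st FA ->]]]]] [[B FB <-]|[s' [t' [B [st' FB ->]]]]].
- by left; exists (A `&` B); [exact: filtrationI|rewrite -setXI setIid].
- rewrite -setXI (_ : _ `&` [set u | _] = set0) ?set0X; first exact: predictable_rectangle0.
  by apply/seteqP; split => u //= -[-> /andP[]]; rewrite -num_lt /= ltNge ge0.
- rewrite -setXI (_ : [set u | _] `&` _ = set0) ?set0X; first exact: predictable_rectangle0.
  by apply/seteqP; split => u //= -[/andP[+ _] uE]; rewrite uE -num_lt /= ltNge ge0.
- rewrite -setXI (_ : [set u | s < u <= t] `&` _ =
      [set u | Order.max s s' < u <= Order.min t t']); last first.
    apply/seteqP; split => u /=; rewrite gt_max le_min.
      by move=> [/andP[-> ->] /andP[-> ->]].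
    by move=> /andP[/andP[-> ->] /andP[-> ->]].
  have [lt|le] := ltP (Order.max s s') (Order.min t t').
    right; exists (Order.max s s'), (Order.min t t'), (A `&` B); split => //.
    apply: filtrationI; first by apply: filtration_mono FA; rewrite le_max lexx.
    by apply: filtration_mono FB; rewrite le_max lexx orbT.
  rewrite (_ : [set u | _] = set0) ?set0X; first exact: predictable_rectangle0.
  apply/seteqP; split => u //= /andP[lu ul].
  by have := le_lt_trans le lu; rewrite ltNge ul.
Qed.

(** Sections at time t of the generating rectangles lie in [F t], because
    (s, t'] contains t only when s < t; hence predictable processes are
    adapted. *)
Lemma predictable_section t B : <<s rect >> B -> F t [set w | B (t, w)].
Proof.
have [saF _ _] := filtF.
pose S : set (set ({nonneg R} * T)) := [set B | F t [set w | B (t, w)]].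
suff : <<s rect >> `<=` S by move=> h /h.
apply: smallest_sub.
  split => [|A SA|A SA].
  - exact: filtration0.
  - have E : [set w | (setT `\` A) (t, w)] = ~` [set w | A (t, w)].
      by apply/seteqP; split => w /=; [case|].
    apply: (eq_ind_r (F t) _ E); rewrite -filtration_measurable.
    by apply: measurableC; rewrite filtration_measurable.
  - rewrite /S/= (_ : [set w | _] = \bigcup_i [set w | A i (t, w)])//.
    rewrite -filtration_measurable; apply: bigcupT_measurable => i.
    by rewrite filtration_measurable; exact: SA.
move=> _ [[A FA <-]|[s [t' [A [st FA ->]]]]]; rewrite /S /=.
- have [->|t0] := eqVneq t 0%:nng.
    rewrite (_ : [set w | _] = A)//.
    by apply/seteqP; split => w //= [].
  rewrite (_ : [set w | _] = set0); first exact: filtration0.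
  by apply/seteqP; split => w //= [/eqP]; rewrite (negbTE t0).
- have [/andP[st' tt]|ntt] := boolP (s < t <= t').
    rewrite (_ : [set w | _] = A); last first.
      by apply/seteqP; split => w /=; [case|split => //; apply/andP].
    exact: (filtration_mono (ltW st')).
  rewrite (_ : [set w | _] = set0); first exact: filtration0.
  by apply/seteqP; split => w //= [h _]; case/negP: ntt.
Qed.

Lemma predictable_adapted (Y : {nonneg R} -> T -> Rcomplex R) t :
  predictable F Y -> measurable_fun setT (Y t : g_sigma_algebraType (F t) -> Rcomplex R).
Proof.
move=> mY _ A mA; rewrite setTI filtration_measurable.
have := mY measurableT A mA; rewrite setTI.
exact: predictable_section.
Qed.

Lemma adapted_measurable t (f : T -> Rcomplex R) :
  measurable_fun setT (f : g_sigma_algebraType (F t) -> Rcomplex R) ->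
  measurable_fun setT f.
Proof.
move=> mf _ A mA; have [_ Fm _] := filtF; apply: (Fm t).
by rewrite -filtration_measurable; exact: mf.
Qed.

Lemma predictable_process (Y : {nonneg R} -> T -> Rcomplex R) :
  predictable F Y -> stochastic_process Y.
Proof. by move=> mY t; apply: (@adapted_measurable t); exact: predictable_adapted. Qed.

(** The time sets that are predictable when seen as deterministic sets. A
    sequence of predictable processes may be indexed by a function of time that
    is measurable for them; and the predictable sigma-algebra is contained in
    their product with the sigma-algebra of events, so that Fubini's theorem
    applies. *)
Definition predictable_time : set (set {nonneg R}) :=
  [set A | <<s rect >> (A `*` setT)].

Lemma sigma_algebra_predictable_time : sigma_algebra setT predictable_time.
Proof.
rewrite /predictable_time; split => /=.
- by rewrite set0X; exact: sigma_algebra0.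
- move=> A /sigma_algebraCD; rewrite !setTD; congr (<<s _ >> _).
  by apply/seteqP; split => -[t w] /=; [move=> h; split => // At; apply: h|case=> h _ []].
- move=> A mA; rewrite (_ : _ `*` _ = \bigcup_i (A i `*` setT)).
    exact: sigma_algebra_bigcup.
  apply/seteqP; split => -[t w] /=; first by case=> -[i _ Ai] _; exists i.
  by case=> i _ [Ai _]; split => //; exists i.
Qed.

Lemma predictable_timeE (A : set (g_sigma_algebraType predictable_time)) :
  measurable A = <<s rect >> (A `*` setT).
Proof.
rewrite -[RHS]/(predictable_time A).
by rewrite -[in RHS](sigma_algebra_id sigma_algebra_predictable_time).
Qed.

Lemma measurable_fun_predictable_product d' (U : measurableType d')
    (f : g_sigma_algebraType rect -> U) :
  measurable_fun setT f ->
  measurable_fun setT (f : g_sigma_algebraType predictable_time * T -> U).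
Proof.
move=> mf _ A mA; have [_ Fm _] := filtF.
have := mf measurableT A mA; apply: smallest_sub.
  split; [exact: measurable0|by move=> B mB; rewrite setTD; exact: measurableC|].
  by move=> B mB; exact: bigcupT_measurable.
move=> _ [[B FB <-]|[s [t [B [st FB ->]]]]]; apply: measurableX; try exact: Fm FB.
  rewrite predictable_timeE; apply: sub_sigma_algebra; left; exists setT => //.
  exact: filtrationT.
rewrite predictable_timeE; apply: sub_sigma_algebra; right; exists s, t, setT.
by split => //; exact: filtrationT.
Qed.

(** Applied to the distance between two predictable processes, this makes
    their distance in mean a measurable function of time. *)
Lemma measurable_predictable_integral (f : {nonneg R} * T -> \bar R) :
  measurable_fun setT (f : g_sigma_algebraType rect -> \bar R) ->
  (forall u, 0 <= f u)%E ->
  measurable_fun setT (fun t : g_sigma_algebraType predictable_time =>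
     \int[P]_w f (t, w))%E.
Proof.
move=> /measurable_fun_predictable_product mf f0.
exact: (@measurable_fun_fubini_tonelli_F _ _ _ _ _ P _ mf).
Qed.

End predictable_sets.

(** * The space of predictable linear processes *)

Section join_families.
Context (V : Type) (k l : nat).
Implicit Types (f : 'I_l -> V) (g : 'I_k -> V).

(** The index families of two elementary processes are concatenated to write
    their sum as an elementary process. *)
Definition join_ord f g (i : 'I_(l + k)) : V :=
  match fintype.split i with inl j => f j | inr j => g j end.

Lemma join_ordP f g (Q : V -> 'I_(l + k) -> Prop) :
  (forall j, Q (f j) (lshift k j)) -> (forall j, Q (g j) (rshift l j)) ->
  forall i, Q (join_ord f g i) i.
Proof.
by move=> Qf Qg i; rewrite /join_ord; case: split_ordP => j ->; [exact: Qf|exact: Qg].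
Qed.

Lemma join_ord_lshift f g j : join_ord f g (lshift k j) = f j.
Proof.
rewrite /join_ord; case: split_ordP => j'; first by move=> /lshift_inj ->.
by move/eqP; rewrite eq_lrshift.
Qed.

Lemma join_ord_rshift f g j : join_ord f g (rshift l j) = g j.
Proof.
rewrite /join_ord; case: split_ordP => j'; last by move=> /rshift_inj ->.
by move/eqP; rewrite eq_rlshift.
Qed.

End join_families.

Section predictable_linear_space.
Context (R : realType) (B : normedModType R) (M : {nonneg R} -> set B).
Hypothesis M0 : forall t, M t 0.
Hypothesis MZD : forall t (a : R) x y, M t x -> M t y -> M t (a *: x + y).
Hypothesis M_mono : forall s t, s <= t -> M s `<=` M t.
Implicit Types (H K : {nonneg R} -> B) (a : R).
Local Notation lbi := (locally_bounded_in M).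

Lemma locally_bounded_in_linear a H K : lbi H -> lbi K ->
  lbi (fun t => a *: K t + H t).
Proof.
move=> [bH MH] [bK MK]; split => t.
  have [x Hx] := bH t; have [y Ky] := bK t.
  exists (`|a| * y + x) => _ [s /= st <-].
  rewrite (le_trans (ler_normD _ _))// lerD//.
    by rewrite normrZ ler_wpM2l//; apply: Ky; exists s.
  by apply: Hx; exists s.
have [u _ Hu] := MH t; have [v _ Kv] := MK t.
exists (Order.max u v) => //; apply: MZD.
  by apply: M_mono Kv; rewrite le_max lexx orbT.
by apply: M_mono Hu; rewrite le_max lexx.
Qed.

Lemma elementary_linear a H K : elementary M H -> elementary M K ->
  elementary M (fun t => a *: K t + H t).
Proof.
move=> [k [s [t [T0 [S [st MT0 MS ->]]]]]] [l [s' [t' [T0' [S' [st' MT0' MS' ->]]]]]].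
exists (l + k)%N, (join_ord s' s), (join_ord t' t), (a *: T0' + T0),
  (join_ord (fun j => a *: S' j) S); split.
- apply: (@join_ordP _ _ _ _ _ (fun x i => x < join_ord t' t i)) => j.
    by rewrite join_ord_lshift.
  by rewrite join_ord_rshift.
- exact: MZD.
- apply: (@join_ordP _ _ _ _ _ (fun x i => M x (join_ord (fun j => a *: S' j) S i))) => j.
    by rewrite join_ord_lshift -[_ *: _]addr0; exact: MZD.
  by rewrite join_ord_rshift.
- apply/funext => u; rewrite big_split_ord/=.
  under [X in _ = _ + (X + _)]eq_bigr => i _ do rewrite !join_ord_lshift scalerA mulrC -scalerA.
  under [X in _ = _ + (_ + X)]eq_bigr => i _ do rewrite !join_ord_rshift.
  rewrite -scaler_sumr !scalerDr !scalerA [\1_ _ _ * _]mulrC.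
  by rewrite -!addrA; congr (_ + _); rewrite addrCA.
Qed.

Lemma predictable_linear_lbi : predictable_linear M `<=` lbi.
Proof.
apply: smallest_sub; last exact: elementary_locally_bounded_in.
by split.
Qed.

Lemma predictable_linear_elementary : elementary M `<=` predictable_linear M.
Proof. exact: sub_gen_smallest. Qed.

Lemma predictable_linear_closed :
  closed_locally_boundedly M (predictable_linear M).
Proof.
move=> Hn H IHn lH cH I [[Ilbi Icl] eI]; apply: (Icl Hn H) => // n.
exact: IHn.
Qed.

(** Minimality alone gives an induction whose limit step knows that the
    approximants satisfy the property; intersecting the property with the
    predictable linear processes lets that step also use that they are
    predictable linear. *)
Lemma predictable_linear_ind (J : set ({nonneg R} -> B)) :
  elementary M `<=` J ->
  (forall Hn H, (forall n, predictable_linear M (Hn n)) -> (forall n, J (Hn n)) -> lbi H ->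
    cvg_locally_boundedly Hn H -> J H) ->
  predictable_linear M `<=` J.
Proof.
move=> eJ cJ H IH.
suff : (predictable_linear M `&` J) H by case.
apply: IH; split; last first.
  by move=> K eK; split; [exact: predictable_linear_elementary|exact: eJ].
split; first by move=> K [] /predictable_linear_lbi.
move=> Hn K JHn lK cK; split.
  by apply: (predictable_linear_closed _ lK cK) => n; case: (JHn n).
by apply: (cJ Hn K) => // n; case: (JHn n).
Qed.

Lemma cvg_locally_boundedly_linear a Kn K H : locally_bounded H ->
  cvg_locally_boundedly Kn K ->
  cvg_locally_boundedly (fun n t => a *: Kn n t + H t) (fun t => a *: K t + H t).
Proof.
move=> bH [cK bK]; split => [s|t].
  by apply: cvgD; [apply: cvgZr; exact: cK|exact: cvg_cst].
have [x Hx] := bH t; have [y Ky] := bK t.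
exists (`|a| * y + x) => _ [[n s] /= st <-].
rewrite (le_trans (ler_normD _ _))// lerD//.
  by rewrite normrZ ler_wpM2l//; apply: Ky; exists (n, s).
by apply: Hx; exists s.
Qed.

Lemma cvg_locally_boundedly_linear_r a Hn H K : locally_bounded K ->
  cvg_locally_boundedly Hn H ->
  cvg_locally_boundedly (fun n t => a *: K t + Hn n t) (fun t => a *: K t + H t).
Proof.
move=> bK [cH bH]; split => [s|t].
  by apply: cvgD; [exact: cvg_cst|exact: cH].
have [x Hx] := bH t; have [y Ky] := bK t.
exists (`|a| * y + x) => _ [[n s] /= st <-].
rewrite (le_trans (ler_normD _ _))// lerD//.
  by rewrite normrZ ler_wpM2l//; apply: Ky; exists s.
by apply: Hx; exists (n, s).
Qed.

(** Linearity in one argument is obtained while the other is elementary, and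
    only then for an arbitrary one: each of the two inductions keeps one
    argument fixed, as in Dynkin's theorem. *)
Lemma predictable_linear_linear a H K :
  predictable_linear M H -> predictable_linear M K ->
  predictable_linear M (fun t => a *: K t + H t).
Proof.
move=> + IK; have lbK := predictable_linear_lbi IK.
move: H; apply: (@predictable_linear_ind
    [set H | predictable_linear M (fun t => a *: K t + H t)]); last first.
  move=> Hn H IHn JHn lH cH; apply: (predictable_linear_closed JHn).
    exact: locally_bounded_in_linear.
  by apply: cvg_locally_boundedly_linear_r => //; case: lbK.
move=> H eH; have lbH := elementary_locally_bounded_in M0 MZD M_mono eH.
move: K IK {lbK}; apply: (@predictable_linear_ind
    [set K | predictable_linear M (fun t => a *: K t + H t)]).
  by move=> K eK; apply: predictable_linear_elementary; exact: elementary_linear.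
move=> Kn K IKn JKn lK cK; apply: (predictable_linear_closed JKn).
  exact: locally_bounded_in_linear.
by apply: cvg_locally_boundedly_linear => //; case: lbH.
Qed.

End predictable_linear_space.

(** * Complex random variables and multiplication operators *)

Lemma normcZ_real (R : realType) (a : R) (z : Rcomplex R) : `|a *: z| = `|a| * `|z|.
Proof.
case: z => u v; rewrite /Num.norm/= !exprMn -mulrDr sqrtrM ?sqr_ge0//.
by rewrite sqrtr_sqr.
Qed.

Lemma normr_complex1 (R : realType) : `|1 : Rcomplex R| = 1.
Proof. by rewrite /Num.norm/= expr1n expr0n/= addr0 sqrtr1. Qed.

Lemma normr_Re_le (R : realType) (z : Rcomplex R) : `|complex.Re z| <= `|z|.
Proof.
by case: z => x y; rewrite -sqrtr_sqr ler_sqrt ?lerDl ?sqr_ge0// addr_ge0 ?sqr_ge0.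
Qed.

Lemma normr_Im_le (R : realType) (z : Rcomplex R) : `|complex.Im z| <= `|z|.
Proof.
by case: z => x y; rewrite -sqrtr_sqr ler_sqrt ?lerDr ?sqr_ge0// addr_ge0 ?sqr_ge0.
Qed.

Lemma measurable_scale_cst d (T : measurableType d) (R : realType) (g : T -> R)
    (c : Rcomplex R) :
  measurable_fun setT g -> measurable_fun setT (fun x => g x *: c).
Proof.
move=> mg; apply/measurable_fun_complexP; case: c => x y.
by split; apply: measurable_funM => //; exact: measurable_cst.
Qed.

Section Lp_class.
Context d (T : measurableType d) (R : realType) (P : probability T R).
Context (r : \bar R) (r1 : (1 <= r)%E).
Implicit Types (f g : T -> Rcomplex R) (y : Lp P r1).

(** A total version of [classLp], with value 0 on functions that agree almost
    surely with no element of L^r; terms then carry no proof of measurability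
    or finiteness. *)
Definition Lp_of f : Lp P r1 := xget 0 [set y : Lp P r1 | repr0 y = f %[ae P]].

Lemma Lp_of_eq y f : repr0 y = f %[ae P] -> Lp_of f = y.
Proof.
move=> yf; rewrite /Lp_of; case: xgetP => [z _ /= zf|/(_ y)//].
apply/val_inj/eqL0P; apply: filterS2 yf zf => w h1 h2 _.
by rewrite h1// h2.
Qed.

Definition in_Lp f := measurable_fun setT f /\ (cLnorm P r f < +oo)%E.

Lemma repr0_Lp_of f : in_Lp f -> repr0 (Lp_of f) = f %[ae P].
Proof.
move=> [mf foo].
by rewrite (@Lp_of_eq (classLp r1 mf foo)); exact: repr_classLp.
Qed.

Lemma norm_Lp_of f : in_Lp f -> (`|Lp_of f|)%:E = cLnorm P r f.
Proof.
move=> Lf; rewrite Lp_normE.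
exact: (ae_eq_cLnorm r1 (measurable_repr0 _) Lf.1 (repr0_Lp_of Lf)).
Qed.

Lemma in_Lp_linear (a : R) f g : in_Lp f -> in_Lp g -> in_Lp (fun w => a *: f w + g w).
Proof.
move=> [mf foo] [mg goo]; have mZf := measurable_complexZ a mf.
split; first exact: (measurable_complexD mZf mg).
apply: (le_lt_trans (cLnormD P r1 mZf mg)).
by rewrite cLnormZ// lte_add_pinfty// lte_mul_pinfty ?lee_fin.
Qed.

Lemma Lp_of_linear (a : R) f g : in_Lp f -> in_Lp g ->
  Lp_of (fun w => a *: f w + g w) = a *: Lp_of f + Lp_of g.
Proof.
move=> Lf Lg; apply: Lp_of_eq.
apply: filterS2 (filterI (repr0D (a *: \val (Lp_of f)) (\val (Lp_of g)))
  (repr0Z a (\val (Lp_of f)))) (filterI (repr0_Lp_of Lf) (repr0_Lp_of Lg)).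
by move=> w [h1 h2] [h3 h4] _; rewrite h1//= h2//= h3// h4.
Qed.

Lemma in_Lp_le f g : measurable_fun setT f -> (forall x, `|f x| <= `|g x|) ->
  in_Lp g -> in_Lp f.
Proof.
move=> mf fg [mg goo]; split => //; apply: le_lt_trans goo.
by apply: ae_le_cLnorm => //; exact: aeW.
Qed.

Lemma cLnorm_cst_le (c : Rcomplex R) : (cLnorm P r (cst c) <= `|c|%:E)%E.
Proof.
case: r r1 => [s| |]// s1.
  rewrite /cLnorm (_ : EFin \o _ = EFin \o (`|c| \*o cst 1)).
    rewrite LnormZ_fun// Lnorm_cst1 [X in (X `^ _)%E]probability_setT.
    by rewrite poweR1r mule1 normr_id.
  by apply/funext => x /=; rewrite mulr1.
have P0 : (0 < P [set: T])%E by rewrite [X in (_ < X)%E]probability_setT.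
rewrite /cLnorm unlock P0; apply/ess_supP; apply: aeW => x /=.
by rewrite normr_id.
Qed.

Lemma in_Lp_cst (c : Rcomplex R) : in_Lp (cst c).
Proof.
split; first exact: measurable_cst.
by apply: le_lt_trans (cLnorm_cst_le c) _; exact: ltry.
Qed.

End Lp_class.

Section Lp_dominated.
Context d (T : measurableType d) (R : realType) (P : probability T R).

(** Dominated convergence for the functions [`|fn n x - f x| `^ r], which are
    at most [(2 * `|f x|) `^ r]. It fails for r = +oo: if sets A_n of
    probability less than 1 increase to the whole space, their indicators stay
    at distance 1 from the constant 1. *)
Lemma Lp_of_dominated (r : \bar R) (r1 : (1 <= r)%E) (fn : nat -> T -> Rcomplex R) f : r != +oo%E ->
  (forall n, measurable_fun setT (fn n)) -> in_Lp P r f ->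
  (forall n x, `|fn n x| <= `|f x|) ->
  (forall x, `|fn n x - f x| @[n --> \oo] --> 0) ->
  Lp_of P r1 (fn n) @[n --> \oo] --> Lp_of P r1 f.
Proof.
move: r r1 => [s| |]// s1 _ mfn Lf fnf cfn.
have s0 : 0 < s by rewrite lee_fin in s1; exact: lt_le_trans s1.
have mdn n : measurable_fun setT (fun x => fn n x - f x).
  exact: (measurable_complexD (mfn n) (measurable_complexN Lf.1)).
have dnf n x : `|fn n x - f x| <= 2 * `|f x|.
  by rewrite (le_trans (ler_normB _ _))// mulr_natl mulr2n lerD.
have L2f : in_Lp P s%:E (fun x => 2 *: f x).
  have := in_Lp_linear s1 (2 : R) Lf (in_Lp_cst P s1 0).
  by congr in_Lp; apply/funext => x; rewrite addr0.
have dnL n : in_Lp P s%:E (fun x => fn n x - f x).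
  apply: (in_Lp_le s1 (mdn n) _ L2f) => x.
  by rewrite normcZ_real [ `|2| ]ger0_norm.
have powN g : (cLnorm P s%:E g `^ s = \int[P]_x (`|g x| `^ s)%:E)%E.
  have sN0 : s != 0 by rewrite gt_eqF.
  rewrite [LHS](poweR_Lnorm P (EFin \o (fun x => `|g x|)) sN0); apply: eq_integral => x _ /=.
  by rewrite normr_id.
have mpow (g : T -> Rcomplex R) : measurable_fun setT g ->
    measurable_fun setT (fun x => (`|g x| `^ s)%:E).
  move=> mg; apply/measurable_EFinP/(@measurableT_comp _ _ _ _ _ _ (@powR R ^~ s)).
    exact: measurable_powR.
  exact: measurable_complex_norm.
have normdn n : (`|Lp_of P s1 (fun x => fn n x - f x)| `^ s)%:E =
    (\int[P]_x (`|fn n x - f x| `^ s)%:E)%E.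
  by rewrite -powN -(norm_Lp_of s1 (dnL n)) poweR_EFin.
have cI : `|Lp_of P s1 (fun x => fn n x - f x)| `^ s @[n --> \oo] --> 0.
  suff /fine_cvg : (`|Lp_of P s1 (fun x => fn n x - f x)| `^ s)%:E @[n --> \oo] --> 0%:E by [].
  under eq_fun do rewrite normdn.
  have <- : (\int[P]_x cst 0 x)%E = 0%:E by rewrite integral0.
  have [| | | | |_ _ //] := @dominated_convergence _ T R P setT measurableT
    (fun n x => (`|fn n x - f x| `^ s)%:E) (cst 0%E) (fun x => (`|2 *: f x| `^ s)%:E).
  - by move=> n; exact: mpow.
  - exact: measurable_cst.
  - apply: aeW => x _; apply/fine_cvgP; split; first exact: nearW.
    apply/cvgr0Pnorm_le => e e0 /=.
    have es0 : 0 < e `^ s^-1 by exact: powR_gt0.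
    near=> n; rewrite ger0_norm ?powR_ge0//.
    have -> : e = (e `^ s^-1) `^ s by rewrite -powRrM mulVf ?gt_eqF// powRr1// ltW.
    rewrite ge0_ler_powR ?nnegrE// ?ltW//.
    near: n; have /cvgr0_norm_lt /(_ _ es0) := cfn x.
    by apply: filterS => n; rewrite normr_id.
  - apply/integrableP; split; first by apply: mpow; exact: measurable_complexZ Lf.1.
    rewrite (eq_integral (fun x => (`|2 *: f x| `^ s)%:E)); last first.
      by move=> x _ /=; rewrite ger0_norm// powR_ge0.
    rewrite -(powN (fun x => 2 *: f x)).
    by rewrite -(norm_Lp_of s1 L2f) poweR_EFin ltry.
  - apply: aeW => x n _ /=; rewrite lee_fin ger0_norm ?powR_ge0//.
    apply: ge0_ler_powR; rewrite ?nnegrE// ?(ltW s0)//.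
    by rewrite normcZ_real [ `|2| ]ger0_norm.
apply/cvgrPdistC_lt => e e0; have es0 : 0 < e `^ s by exact: powR_gt0.
have /cvgr0_norm_lt /(_ _ es0) := cI; apply: filterS => n.
have -> : Lp_of P s1 (fn n) - Lp_of P s1 f = Lp_of P s1 (fun x => fn n x - f x).
  rewrite addrC -scaleN1r -Lp_of_linear//; last exact: in_Lp_le (fnf n) Lf.
  by congr Lp_of; apply/funext => x; rewrite scaleN1r addrC.
rewrite ger0_norm ?powR_ge0//; rewrite !ltNge; apply: contra => le.
by rewrite ge0_ler_powR ?nnegrE// ltW.
Unshelve. all: by end_near. Qed.

End Lp_dominated.

Section L1.
Context d (T : measurableType d) (R : realType) (P : probability T R).

(** Hoelder's inequality against the constant 1, whose norm is at most 1 on a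
    probability space. The conjugate exponent is computed as the inverse of
    1 - 1/q in the extended reals, which covers q = 1 and q = +oo as well. *)
Lemma L1_le_cLnorm (q : \bar R) (f : T -> Rcomplex R) : (1 <= q)%E -> in_Lp P q f ->
  (\int[P]_w (`|f w|)%:E <= cLnorm P q f)%E.
Proof.
move=> q1 [mf foo].
have [x [qx x0 x1]] : exists x : R, [/\ q^-1%E = x%:E, 0 <= x & x <= 1].
  case: q q1 {foo} => [s| |]// s1; last by exists 0; rewrite invey.
  have s0 : 0 < s by rewrite lee_fin in s1; exact: lt_le_trans s1.
  by exists s^-1; rewrite inver gt_eqF// invr_ge0 (ltW s0) invf_le1.
pose p : \bar R := ((1 - x)%:E^-1)%E.
have p1 : (1 <= p)%E.
  rewrite /p inver; case: eqP => [_|/eqP xN1]; first exact: leey.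
  have x1' : 0 < 1 - x by rewrite lt_neqAle eq_sym xN1 subr_ge0.
  by rewrite lee_fin invf_ge1// gerBl.
have qp : (q^-1 + p^-1 = 1^-1)%E.
  by rewrite /p inveK qx -EFinD addrC subrK inver oner_eq0 invr1.
have [m1 foo1] := in_Lp_cst P p1 1.
have := cLnorm_hoelder p1 (lexx 1%E) q1 qp mf m1 foo foo1.
rewrite {1}/cLnorm Lnorm1 (eq_integral (fun w => (`|f w|)%:E)); last first.
  by move=> w _ /=; rewrite mulr1 normr_id.
move=> /le_trans; apply; rewrite -[leRHS]mule1 lee_wpmul2l ?cLnorm_ge0//.
by rewrite (le_trans (cLnorm_cst_le P p1 1))// normr_complex1.
Qed.

End L1.

Section mulop.
Context d (T : measurableType d) (R : realType) (P : probability T R).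
Context (p q r : \bar R) (p1 : (1 <= p)%E) (q1 : (1 <= q)%E) (r1 : (1 <= r)%E).
Hypothesis pqr : (r^-1 + p^-1 = q^-1)%E.
Local Notation mulop := (mulop p1 q1 pqr).
Local Notation one := (Lp_of P p1 (cst 1)).

Lemma norm_mulop_le (y : Lp P r1) : `|mulop y| <= `|y|.
Proof.
rewrite Bop_normE; apply: opnorm_le => x x1.
by apply: (le_trans (norm_mulLp q1 pqr y x)); rewrite ler_piMr.
Qed.

Lemma mulopB (y z : Lp P r1) : mulop (y - z) = mulop y - mulop z.
Proof. by rewrite -scaleN1r addrC mulop_linear scaleN1r addrC. Qed.

Lemma mulopD (y z : Lp P r1) : mulop (y + z) = mulop y + mulop z.
Proof. by rewrite -[y in LHS]scale1r mulop_linear scale1r. Qed.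

Lemma mulop0 : mulop (0 : Lp P r1) = 0.
Proof. by rewrite -(subrr (0 : Lp P r1)) mulopB subrr. Qed.

Lemma mulopZ (a : R) (y : Lp P r1) : mulop (a *: y) = a *: mulop y.
Proof. by rewrite -[a *: y]addr0 mulop_linear mulop0 addr0. Qed.

(** The constant function 1 lies in L^p, and evaluation there recovers y from
    the operator: hence the injectivity of [mulop], and the control of y by the
    operator norm in [L1_le_norm_mulop]. *)
Lemma mulop_one (y : Lp P r1) : repr0 (mulop y one) = repr0 y %[ae P].
Proof.
apply: filterS2 (repr0M y one) (repr0_Lp_of p1 (in_Lp_cst P p1 1)) => w h1 h2 _.
by rewrite h1//= h2//= mulr1.
Qed.

Lemma mulop_inj : injective (mulop : Lp P r1 -> _).
Proof.
move=> y z yz; apply/val_inj/eqL0P.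
have := mulop_one z; rewrite -yz.
by apply: filterS2 (mulop_one y) => w h1 h2 _; rewrite -h1// h2.
Qed.

Lemma norm_one_le : `|one| <= 1.
Proof.
rewrite -lee_fin norm_Lp_of; last exact: in_Lp_cst.
by apply: le_trans (cLnorm_cst_le P p1 1) _; rewrite normr_complex1.
Qed.

Lemma L1_le_norm_mulop (y : Lp P r1) :
  (\int[P]_w (`|repr0 y w|)%:E <= (`|mulop y|)%:E)%E.
Proof.
have Ly1 : in_Lp P q (repr0 (mulop y one)).
  by split; [exact: measurable_repr0|exact: Lp_valP].
have my : measurable_fun setT (repr0 y) by exact: measurable_repr0.
apply: (@le_trans _ _ (cLnorm P q (repr0 (mulop y one)))); last first.
  rewrite -Lp_normE lee_fin; apply: (le_trans (le_opnorm (mulop y) one)).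
  by rewrite ler_piMr ?opnorm_ge0// norm_one_le.
apply: le_trans (L1_le_cLnorm q1 Ly1); apply: ae_ge0_le_integral => //.
- by apply/measurable_EFinP; exact: measurable_complex_norm.
- by apply/measurable_EFinP; apply: measurable_complex_norm; case: Ly1.
- by apply: filterS (mulop_one y) => w -> .
Qed.

End mulop.

(** * Predictable processes give predictable linear processes *)

Section predictable_to_linear.
Context d (T : measurableType d) (R : realType) (P : probability T R).
Context (p q r : \bar R) (p1 : (1 <= p)%E) (q1 : (1 <= q)%E) (r1 : (1 <= r)%E).
Hypothesis pqr : (r^-1 + p^-1 = q^-1)%E.
Variable F : {nonneg R} -> set (set T).
Hypothesis filtF : filtration F.
Implicit Types (X Y : {nonneg R} -> T -> Rcomplex R) (c : Rcomplex R).
Local Notation M := (mulops P p1 q1 r1 pqr F).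
Local Notation mulop := (mulop p1 q1 pqr).
Local Notation rect := (predictable_rectangle F).

Definition multiplication_process Y (t : {nonneg R}) := mulop (Lp_of P r1 (Y t)).

Lemma Lr_locally_boundedP Y : Lr_locally_bounded P r Y <->
  forall t, exists C : R, forall s, s <= t -> (cLnorm P r (Y s) <= C%:E)%E.
Proof.
split=> bY t.
  exists (fine (ereal_sup [set cLnorm P r (Y s) | s in [set s | s <= t]])) => s st.
  have supI : (cLnorm P r (Y s) <= ereal_sup [set cLnorm P r (Y s) | s in [set s | (s <= t)%R]])%E.
    by apply: ereal_sup_ubound; exists s.
  by rewrite fineK// ge0_fin_numE//; apply: le_trans supI; exact: cLnorm_ge0.
have [C YC] := bY t; apply: (@le_lt_trans _ _ C%:E); last exact: ltry.
by apply: ge_ereal_sup => _ [s st <-]; exact: YC.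
Qed.

Definition Lr_predictable Y := predictable F Y /\ Lr_locally_bounded P r Y.

Lemma Lr_predictable_in_Lp Y t : Lr_predictable Y -> in_Lp P r (Y t).
Proof.
by move=> [mY bY]; split; [exact: (predictable_process filtF mY)|exact: Lr_locally_bounded_fin].
Qed.

Lemma Lr_predictable_norm Y t : Lr_predictable Y ->
  exists C, forall s, s <= t -> `|Lp_of P r1 (Y s)| <= C.
Proof.
move=> LY; have [_ /Lr_locally_boundedP/(_ t)[C YC]] := LY; exists C => s st.
by rewrite -lee_fin norm_Lp_of; [exact: YC|exact: Lr_predictable_in_Lp].
Qed.

Lemma multiplication_process_lbi Y : Lr_predictable Y ->
  locally_bounded_in M (multiplication_process Y).
Proof.
move=> LY; split => t.
  have [C YC] := Lr_predictable_norm t LY; exists C => _ [s /= st <-].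
  by rewrite (le_trans (norm_mulop_le _ _ _ _))// YC.
exists t => //; exists (Lp_of P r1 (Y t)) => //.
exists (Y t); first exact: (predictable_adapted filtF LY.1).
exact/repr0_Lp_of/Lr_predictable_in_Lp.
Qed.

Lemma Lr_predictable_linear (a : R) X Y : Lr_predictable X -> Lr_predictable Y ->
  Lr_predictable (fun t w => a *: X t w + Y t w).
Proof.
move=> LX LY; split.
  exact: (measurable_complexD (measurable_complexZ a LX.1) LY.1).
apply/Lr_locally_boundedP => t.
have [C XC] := Lr_predictable_norm t LX; have [D YD] := Lr_predictable_norm t LY.
exists (`|a| * C + D) => s st.
have inX := Lr_predictable_in_Lp s LX; have inY := Lr_predictable_in_Lp s LY.
rewrite -(norm_Lp_of r1 (in_Lp_linear r1 a inX inY)) lee_fin Lp_of_linear//.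
rewrite (le_trans (ler_normD _ _))// lerD ?YD//.
by rewrite normrZ ler_wpM2l// XC.
Qed.

Lemma Lr_predictable_le X Y : predictable F X -> Lr_predictable Y ->
  (forall t w, `|X t w| <= `|Y t w|) -> Lr_predictable X.
Proof.
move=> mX LY XY; split => //; apply/Lr_locally_boundedP => t.
have [C YC] := (Lr_locally_boundedP Y).1 LY.2 t; exists C => s st.
apply: le_trans (YC _ st); apply: ae_le_cLnorm => //.
- exact: (predictable_process filtF mX).
- exact: (predictable_process filtF LY.1).
- exact: aeW.
Qed.

Lemma Lr_predictable_cst c : Lr_predictable (fun=> cst c).
Proof.
split; first exact: measurable_cst.
apply/Lr_locally_boundedP => t; exists (`|Lp_of P r1 (cst c)|) => s _.
by rewrite norm_Lp_of//; exact: in_Lp_cst.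
Qed.

(** The property carried through the monotone class argument. *)
Definition mul_predictable Y :=
  Lr_predictable Y /\ predictable_linear M (multiplication_process Y).

Lemma mul_predictable_linear (a : R) X Y : mul_predictable X -> mul_predictable Y ->
  mul_predictable (fun t w => a *: X t w + Y t w).
Proof.
move=> [LX IX] [LY IY]; split; first exact: Lr_predictable_linear.
have M0 := mulops0 P p1 q1 r1 pqr F.
have MZD t b (x y : Bop (Lp P p1) (Lp P q1)) : M t x -> M t y -> M t (b *: x + y).
  exact: mulops_linear.
have Mm s t : s <= t -> M s `<=` M t by exact: mulops_mono.
have -> : multiplication_process (fun t w => a *: X t w + Y t w) =
    (fun t => a *: multiplication_process X t + multiplication_process Y t).
  apply/funext => t; rewrite /multiplication_process -mulop_linear Lp_of_linear//;
    exact: Lr_predictable_in_Lp.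
exact: predictable_linear_linear.
Qed.

(** The norm of M_y is at most that of y, so that convergence in L^r at each
    time gives convergence in operator norm; domination by Y gives the uniform
    bound. *)
Lemma mul_predictable_dominated (Yn : nat -> {nonneg R} -> T -> Rcomplex R) Y : r != +oo%E ->
  (forall n, mul_predictable (Yn n)) -> Lr_predictable Y ->
  (forall n t w, `|Yn n t w| <= `|Y t w|) ->
  (forall t w, `|Yn n t w - Y t w| @[n --> \oo] --> 0) -> mul_predictable Y.
Proof.
move=> roo gYn LY YnY cYn; split => //.
apply: (predictable_linear_closed (Hn := fun n => multiplication_process (Yn n))).
- by move=> n; case: (gYn n).
- exact: multiplication_process_lbi.
split => t.
  apply/cvgrPdistC_lt => e e0.
  have /cvgrPdistC_lt /(_ _ e0) : Lp_of P r1 (Yn n t) @[n --> \oo] --> Lp_of P r1 (Y t).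
    apply: Lp_of_dominated => //.
    - by move=> n; have [[mYn _] _] := gYn n; exact: (predictable_process filtF mYn).
    - exact: Lr_predictable_in_Lp.
  apply: filterS => n; apply: le_lt_trans.
  by rewrite /multiplication_process -mulopB norm_mulop_le.
have [C YC] := Lr_predictable_norm t LY; exists C => _ [[n s] /= st <-].
rewrite (le_trans (norm_mulop_le _ _ _ _))// (le_trans _ (YC _ st))//.
have [LYn _] := gYn n; rewrite -lee_fin !norm_Lp_of; try exact: Lr_predictable_in_Lp.
apply: ae_le_cLnorm => //; try by case: (Lr_predictable_in_Lp s LYn).
  by case: (Lr_predictable_in_Lp s LY).
exact: aeW.
Qed.

(** The complex coefficient c is carried along because the stability results
    for predictable linear processes only allow real combinations. *)
Definition indicator_process (B : set ({nonneg R} * T)) c t w : Rcomplex R :=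
  \1_B (t, w) *: c.

Lemma Lr_predictable_indicator B c : <<s rect >> B ->
  Lr_predictable (indicator_process B c).
Proof.
move=> mB; apply: (Lr_predictable_le (Y := fun=> cst c)).
- have mI : measurable_fun setT (\1_B : g_sigma_algebraType rect -> R).
    exact: (@measurable_indic _ (g_sigma_algebraType rect) R setT B mB).
  by apply: eq_measurable_fun (measurable_scale_cst c mI) => -[].
- exact: Lr_predictable_cst.
- move=> t w; rewrite normcZ_real /= indicE; case: (_ \in _).
    by rewrite normr1 mul1r.
  by rewrite normr0 mul0r.
Qed.

Lemma multiplication_process_setX (S : set {nonneg R}) (A : set T) c u :
  multiplication_process (indicator_process (S `*` A) c) u =
  \1_S u *: mulop (Lp_of P r1 (fun w => \1_A w *: c)).
Proof.
rewrite /multiplication_process indicE; have [uS|uS] := boolP (u \in S).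
  rewrite scale1r; congr (mulop (Lp_of _ _ _)); apply/funext => w.
  by rewrite /indicator_process !indicE in_setX/= uS.
rewrite scale0r -(mulop0 P p1 q1 r1 pqr); congr mulop; apply: Lp_of_eq.
apply: filterS (repr00 P) => w /= h _; rewrite h//=.
by rewrite /indicator_process indicE in_setX/= (negbTE uS) scale0r.
Qed.

Lemma mulops_indicator t A c : F t A -> M t (mulop (Lp_of P r1 (fun w => \1_A w *: c))).
Proof.
move=> FA; exists (Lp_of P r1 (fun w => \1_A w *: c)) => //.
have mf : measurable_fun setT ((fun w => \1_A w *: c) : g_sigma_algebraType (F t) -> Rcomplex R).
  have mI : measurable_fun setT (\1_A : g_sigma_algebraType (F t) -> R).
    by apply: measurable_indic; rewrite filtration_measurable.
  exact: (measurable_scale_cst c mI).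
exists (fun w => \1_A w *: c) => //; apply: repr0_Lp_of.
apply: (in_Lp_le r1 (adapted_measurable filtF mf) _ (in_Lp_cst P r1 c)) => w.
rewrite normcZ_real /= indicE; case: (_ \in _).
  by rewrite normr1 mul1r.
by rewrite normr0 mul0r.
Qed.

Lemma mul_predictable_rectangle B c : rect B -> mul_predictable (indicator_process B c).
Proof.
move=> rB; split; first by apply: Lr_predictable_indicator; apply: sub_sigma_algebra.
apply: predictable_linear_elementary; case: rB => [[A FA <-]|[s [t [A [st FA ->]]]]].
  exists 0%N, (fun=> 0%:nng), (fun=> 0%:nng), (mulop (Lp_of P r1 (fun w => \1_A w *: c))),
    (fun=> 0); split.
  - by case.
  - exact: mulops_indicator.
  - by case.
  - by apply/funext => u; rewrite big_ord0 addr0 multiplication_process_setX.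
exists 1%N, (fun=> s), (fun=> t), 0, (fun=> mulop (Lp_of P r1 (fun w => \1_A w *: c))); split.
- by [].
- exact: mulops0.
- by move=> _; exact: mulops_indicator.
- by apply/funext => u; rewrite big_ord1 scaler0 add0r multiplication_process_setX.
Qed.

Hypothesis roo : r != +oo%E.

(** Stated for sequences of subsets of B that eventually contain each point of
    B, which covers both the exhaustion of the time axis and countable disjoint
    unions; the indicators are then dominated by that of B. *)
Lemma mul_predictable_indicator_cvg (Bn : nat -> set ({nonneg R} * T)) B c :
  (forall n, mul_predictable (indicator_process (Bn n) c)) -> <<s rect >> B ->
  (forall n, Bn n `<=` B) -> (forall u, B u -> \forall n \near \oo, Bn n u) ->
  mul_predictable (indicator_process B c).
Proof.
move=> gBn mB BnB cB; apply: (mul_predictable_dominated roo gBn).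
- exact: Lr_predictable_indicator.
- move=> n t w; rewrite !normcZ_real ler_wpM2r// !indicE !ger0_norm// ler_nat.
  have [/set_mem/BnB/mem_set ->//|//] := boolP ((t, w) \in Bn n).
- move=> t w; apply: cvg_near_cst; have [Btw|nB] := pselect (B (t, w)).
    apply: filterS (cB _ Btw) => n Bn_.
    by rewrite /indicator_process !indicE !mem_set// subrr normr0.
  apply: nearW => n.
  by rewrite /indicator_process !indicE !memNset// ?subrr ?normr0// => /BnB.
Qed.

Lemma mul_predictable_indicatorU (A B : set ({nonneg R} * T)) c : A `&` B = set0 ->
  mul_predictable (indicator_process A c) -> mul_predictable (indicator_process B c) ->
  mul_predictable (indicator_process (A `|` B) c).
Proof.
move=> AB gA gB; have := mul_predictable_linear 1 gA gB; congr mul_predictable.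
apply/funext => t; apply/funext => w; rewrite /indicator_process scale1r -scalerDl.
congr (_ *: _); rewrite !indicE in_setU.
have [/set_mem At|_] := boolP ((t, w) \in A); last by rewrite add0r.
rewrite memNset ?addr0//= => Bt.
have : (A `&` B) (t, w) by [].
by rewrite AB.
Qed.

(** Dynkin's theorem for the generating rectangles. The whole space is not a
    rectangle: it is exhausted by {0} and the intervals (0, n + 1]. *)
Lemma mul_predictable_indicator B c : <<s rect >> B -> mul_predictable (indicator_process B c).
Proof.
have gT : mul_predictable (indicator_process setT c).
  apply: (mul_predictable_indicator_cvg
    (Bn := fun n => ([set 0%:nng] `*` setT) `|` ([set u | 0%:nng < u <= n.+1%:R%:nng] `*` setT))).
  - move=> n; apply: mul_predictable_indicatorU.
    + by apply/seteqP; split => -[u w] //= [[-> _]]; rewrite ltxx => -[].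
    + by apply: mul_predictable_rectangle; left; exists setT => //; exact: filtrationT.
    + apply: mul_predictable_rectangle; right; exists 0%:nng, n.+1%:R%:nng, setT.
      by split => //; exact: filtrationT.
  - exact: (@measurableT _ (g_sigma_algebraType rect)).
  - by [].
  - move=> [u w] _; near=> n; have [->|u0] := eqVneq u 0%:nng; [by left|right].
    split => //=; rewrite lt_neqAle eq_sym u0/=; apply/andP; split.
      by rewrite -num_le/=.
    rewrite -num_le/=; near: n.
    exists (Num.bound u%:num) => // n /= un.
    by rewrite (le_trans (ltW (archi_boundP _)))// ler_nat (leq_trans un).
move: B; apply: (@dynkin_induction _ (g_sigma_algebraType rect) rect
  (fun B => mul_predictable (indicator_process B c))) => //.
- exact: predictable_rectangleI.
- by move=> B; exact: mul_predictable_rectangle.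
- move=> S mS gS; have := mul_predictable_linear (-1) gS gT; congr mul_predictable.
  apply/funext => t; apply/funext => w; rewrite /indicator_process scaleN1r -scaleNr -scalerDl.
  congr (_ *: _); rewrite !indicE in_setC in_setT.
  by case: (_ \in _); rewrite /= ?oppr0 ?add0r// addNr.
- move=> B mB tB gB; apply: (mul_predictable_indicator_cvg
    (Bn := fun n => \big[setU/set0]_(i < n.+1) B i)).
  + elim=> [|n IHn]; first by rewrite big_ord1.
    rewrite big_ord_recr; apply: mul_predictable_indicatorU => //.
    rewrite -bigcup_mkord setI_bigcupl; apply: bigcup0 => i /= ni.
    by move/trivIsetP : tB => /(_ i n.+1 I I); apply; rewrite ltn_eqF.
  + exact: sigma_algebra_bigcup.
  + by move=> n; exact: bigsetU_bigcup.
  + move=> u [i _ Bi]; exists i => // n /= ni.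
    by rewrite -bigcup_mkord; exists i.
Unshelve. all: by end_near. Qed.

Import HBNNSimple.

Lemma mul_predictable_simple (h : {nnsfun g_sigma_algebraType rect >-> R}) c :
  mul_predictable (fun t w => h (t, w) *: c).
Proof.
pose a : seq R := fset_set (range h).
have -> : (fun t w => h (t, w) *: c) = (fun t w =>
    (\sum_(i < size a) (a`_i * \1_(h @^-1` [set a`_i]) (t, w))) *: c).
  by apply/funext => t; apply/funext => w; rewrite fimfunEord.
elim: (size a) => [|n IHn].
  have := mul_predictable_indicator c (@measurable0 _ (g_sigma_algebraType rect)).
  congr mul_predictable.
  by apply/funext => t; apply/funext => w; rewrite /indicator_process indic0 big_ord0.
have my : <<s rect >> (h @^-1` [set a`_n]) by exact: (measurable_sfunP h).
have := mul_predictable_linear a`_n (mul_predictable_indicator c my) IHn; congr mul_predictable.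
by apply/funext => t; apply/funext => w; rewrite big_ord_recr/= addrC scalerDl scalerA.
Qed.

(** The simple approximations increase to f, so they are dominated by it. *)
Lemma mul_predictable_nonneg (f : {nonneg R} * T -> R) c :
  measurable_fun setT (f : g_sigma_algebraType rect -> R) -> (forall u, 0 <= f u) ->
  Lr_predictable (fun t w => f (t, w) *: c) -> mul_predictable (fun t w => f (t, w) *: c).
Proof.
move=> mf f0 Lf; have mEf := (measurable_EFinP _ _).2 mf.
pose h := nnsfun_approx measurableT mEf.
have ch u : h n u @[n --> \oo] --> f u.
  suff /fine_cvg : EFin \o h ^~ u @ \oo --> (f u)%:E by [].
  apply: (@cvg_nnsfun_approx _ _ _ _ measurableT _ mEf) => // x _.
  by rewrite lee_fin.
have hf n u : h n u <= f u.
  have ndh : nondecreasing_seq (h ^~ u).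
    by move=> a b ab; have /lefP := nd_nnsfun_approx measurableT mEf ab; exact.
  have := nondecreasing_cvgn_le ndh (cvgP _ (ch u)) n.
  by have /cvg_lim -> := ch u.
apply: (mul_predictable_dominated (Yn := fun n t w => h n (t, w) *: c)) => //.
- by move=> n; exact: mul_predictable_simple.
- move=> n t w; rewrite !normcZ_real ler_wpM2r// !ger0_norm//.
- move=> t w; under eq_fun do rewrite -scalerBl normcZ_real.
  rewrite -(mul0r `|c|); apply: cvgMl.
  apply/cvgr0Pnorm_lt => e e0; have /cvgrPdistC_lt /(_ _ e0) := ch (t, w).
  by apply: filterS => n; rewrite normr_id.
Qed.

(** The process is split into the positive and negative parts of its real and
    imaginary parts, each of which it dominates. *)
Lemma predictable_mul_predictable Y : Lr_predictable Y -> mul_predictable Y.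
Proof.
move=> LY; have [mRe mIm] := (measurable_fun_complexP _).1 LY.1.
have part (f : {nonneg R} * T -> R) c : `|c| <= 1 ->
    measurable_fun setT (f : g_sigma_algebraType rect -> R) ->
    (forall t w, `|f (t, w)| <= `|Y t w|) -> mul_predictable (fun t w => f (t, w) *: c).
  move=> c1 mf fY.
  have g b : `|b| = 1 -> mul_predictable (fun t w => Num.max 0 (b * f (t, w)) *: c).
    move=> b1; have mg : measurable_fun setT
        ((fun u => Num.max 0 (b * f u)) : g_sigma_algebraType rect -> R).
      apply: measurable_maxr; first exact: measurable_cst.
      by apply: measurable_funM => //; exact: measurable_cst.
    apply: (mul_predictable_nonneg (f := fun u => Num.max 0 (b * f u))) => //.
      by move=> u; rewrite le_max lexx.
    apply: (Lr_predictable_le _ LY).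
      by apply: eq_measurable_fun (measurable_scale_cst c mg) => -[].
    move=> t w; rewrite normcZ_real (le_trans (ler_piMr _ c1))// ger0_norm ?le_max ?lexx//.
    by rewrite ge_max normr_ge0/= (le_trans (ler_norm _))// normrM b1 mul1r.
  have := mul_predictable_linear (-1) (g (-1) (normrN1 _)) (g 1 (normr1 _)).
  congr mul_predictable; apply/funext => t; apply/funext => w; rewrite scaleN1r -scaleNr -scalerDl.
  congr (_ *: _); rewrite mul1r mulN1r; case: (leP 0 (f (t, w))) => f0.
    by rewrite max_l ?oppr_le0// oppr0 add0r.
  by rewrite max_r ?opprK ?addr0// oppr_ge0 ltW.
have n1 : `|(1 : Rcomplex R)| <= 1 by rewrite normr_complex1.
have ni : `|(Complex 0 1 : Rcomplex R)| <= 1.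
  by rewrite /Num.norm/= expr1n expr0n/= add0r sqrtr1.
have gRe := part (fun u => complex.Re (Y u.1 u.2)) 1 n1 mRe (fun t w => normr_Re_le (Y t w)).
have gIm := part (fun u => complex.Im (Y u.1 u.2)) (Complex 0 1) ni mIm (fun t w => normr_Im_le (Y t w)).
have := mul_predictable_linear 1 gRe gIm; congr mul_predictable.
apply/funext => t; apply/funext => w /=; rewrite scale1r; case: (Y t w) => x y /=.
by congr Complex; rewrite /= ?mulr0 ?mulr1 ?addr0 ?add0r.
Qed.

End predictable_to_linear.

(** * Limits in mean of predictable processes *)

(** The least admissible index works: it equals n on C n minus the union of the
    earlier C i. *)
Lemma measurable_index d (I : measurableType d) (C : nat -> set I) :
  (forall n, measurable (C n)) -> (forall t, exists n, C n t) ->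
  exists N : I -> nat, (forall n, measurable (N @^-1` [set n])) /\ forall t, C (N t) t.
Proof.
move=> mC exC; have exC' t : exists n, `[< C n t >].
  by have [n Cn] := exC t; exists n; exact/asboolP.
pose N t := ex_minn (exC' t).
exists N; split => [n|t]; last first.
  by rewrite /N; case: ex_minnP => n /asboolP.
rewrite (_ : _ @^-1` _ = C n `\` \bigcup_(i in [set i | (i < n)%N]) C i).
  by apply: measurableD => //; exact: bigcup_measurable.
apply/seteqP; split => t /=.
  rewrite /N; case: ex_minnP => m /asboolP Cm minm <-; split => // -[i /= im Ci].
  by have := minm i; rewrite leqNgt im => /(_ _)/negP; apply => //; exact/asboolP.
move=> [Cn nC]; rewrite /N; case: ex_minnP => m /asboolP Cm minm.
apply/eqP; rewrite eqn_leq minm ?andbT; last exact/asboolP.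
by rewrite leqNgt; apply/negP => nm; apply: nC; exists m.
Qed.

Section ae_convergence.
Context d (T : measurableType d) (R : realType) (P : probability T R).
Implicit Types (f g h : T -> Rcomplex R).

Definition L1dist f g : \bar R := (\int[P]_w (`|f w - g w|)%:E)%E.

Lemma measurable_dist f g : measurable_fun setT f -> measurable_fun setT g ->
  measurable_fun setT (fun w => (`|f w - g w|)%:E).
Proof.
move=> mf mg; apply/measurable_EFinP/measurable_complex_norm.
exact: (measurable_complexD mf (measurable_complexN mg)).
Qed.

Lemma L1dist_triangle f g h : measurable_fun setT f -> measurable_fun setT g ->
  measurable_fun setT h -> (L1dist f h <= L1dist f g + L1dist g h)%E.
Proof.
move=> mf mg mh; rewrite /L1dist -ge0_integralD//; try exact: measurable_dist.
apply: ge0_le_integral => //; try exact: measurable_dist.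
- by apply: emeasurable_funD; exact: measurable_dist.
- by move=> w _; rewrite -EFinD lee_fin ler_distD.
Qed.

Lemma L1dist_sym f g : L1dist f g = L1dist g f.
Proof. by apply: eq_integral => w _; rewrite distrC. Qed.

(** The sum of the distances is integrable, hence almost surely finite, hence
    its terms tend to 0. *)
Lemma L1dist_cvg_ae (f : nat -> T -> Rcomplex R) h :
  (forall k, measurable_fun setT (f k)) -> measurable_fun setT h ->
  (forall k, L1dist (f k) h <= (1 / (2 ^ k.+1)%:R)%:E)%E ->
  \forall w \ae P, `|f k w - h w| @[k --> \oo] --> 0.
Proof.
move=> mf mh fh.
pose S w := (\sum_(k <oo) (`|f k w - h w|)%:E)%E.
have mS : measurable_fun setT S.
  by apply: ge0_emeasurable_sum => // k _; exact: measurable_dist.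
have S0 w : (0 <= S w)%E by apply: nneseries_ge0.
have iS : P.-integrable setT S.
  apply/integrableP; split => //.
  rewrite (eq_integral S); last by move=> w _; rewrite gee0_abs.
  rewrite integral_nneseries//; last by move=> k; exact: measurable_dist.
  apply: (@le_lt_trans _ _ 1%:E); last exact: ltry.
  apply: le_trans (epsilon_trick0 xpredT (@ler01 R)).
  by apply: lee_nneseries => [k _ _|k _]; [exact: integral_ge0|exact: fh].
have := integrable_ae measurableT iS; apply: filterS => w /(_ I) Sfin.
apply: cvg_series_cvg_0; apply: nnseries_is_cvg => //.
by rewrite ltey_eq Sfin.
Qed.

End ae_convergence.

Section predictable_limit.
Context d (T : measurableType d) (R : realType) (P : probability T R).
Variable F : {nonneg R} -> set (set T).
Hypothesis filtF : filtration F.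
Local Notation rect := (predictable_rectangle F).
Implicit Types (Y : {nonneg R} -> T -> Rcomplex R).

Lemma predictable_time_index (Yn : nat -> {nonneg R} -> T -> Rcomplex R)
    (N : {nonneg R} -> nat) :
  (forall n, predictable F (Yn n)) ->
  (forall n, predictable_time F (N @^-1` [set n])) ->
  predictable F (fun t => Yn (N t) t).
Proof.
move=> mY mN _ A mA; rewrite setTI.
rewrite (_ : _ @^-1` _ = \bigcup_n (((N @^-1` [set n]) `*` setT) `&`
    ((fun u => Yn n u.1 u.2) @^-1` A))).
  apply: (@bigcupT_measurable _ (g_sigma_algebraType rect)) => n.
  apply: (@measurableI _ (g_sigma_algebraType rect)); first exact: mN.
  by rewrite -[X in measurable X]setTI; exact: mY.
apply/seteqP; split => -[t w] /=; first by move=> h; exists (N t).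
by move=> [n _ [[/= -> _]]].
Qed.

(** Limits in mean at each time of predictable processes have predictable
    versions. The limit h is only given separately at each time, so it cannot
    be used to select a subsequence measurably in t; the Cauchy condition,
    which involves the predictable processes alone, can. *)
Lemma predictable_limit (Yn : nat -> {nonneg R} -> T -> Rcomplex R)
    (h : {nonneg R} -> T -> Rcomplex R) :
  (forall n, predictable F (Yn n)) -> (forall t, measurable_fun setT (h t)) ->
  (forall t e, 0 < e -> \forall n \near \oo, (L1dist P (Yn n t) (h t) <= e%:E)%E) ->
  exists2 Y, predictable F Y & forall t, Y t = h t %[ae P].
Proof.
move=> mY mh cY; pose Tm := g_sigma_algebraType (predictable_time F).
have mYt n t := predictable_process filtF (mY n) t.
(* The k-th selected process is within [e k] of the limit, and these sum to 1. *)
pose e k : R := 1 / (2 ^ k.+1)%:R.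
have e0 k : 0 < e k by rewrite divr_gt0// ltr0n expn_gt0.
(* [C k n] is the set of times at which the processes of index at least n are
   within [e k] of each other. *)
pose C k n : set Tm := \bigcap_m \bigcap_l
  [set t | (L1dist P (Yn (n + m)%N t) (Yn (n + l)%N t) <= (e k)%:E)%E].
have mC k n : measurable (C k n).
  apply: bigcapT_measurable => m; apply: bigcapT_measurable => l.
  rewrite -[X in measurable X]setTI; apply: measurable_lee => //.
  apply: (measurable_predictable_integral P filtF
    (f := fun u => (`|Yn (n + m)%N u.1 u.2 - Yn (n + l)%N u.1 u.2|)%:E)) => //.
  exact: (measurable_dist (mY (n + m)%N) (mY (n + l)%N)).
have exC k t : exists n, C k n t.
  have [n _ ne] := cY t (e k / 2) (divr_gt0 (e0 k) (ltr0n _ 2)).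
  exists n => m _ l _ /=; have mn j : (n <= n + j)%N by rewrite leq_addr.
  apply: le_trans (L1dist_triangle P (mYt _ t) (mh t) (mYt _ t)) _.
  by rewrite [X in (_ + X)%E]L1dist_sym (splitr (e k)) EFinD leeD//; apply: ne => /=.
have /choice[N HN] k := measurable_index (mC k) (exC k).
pose Z k t := Yn (N k t) t.
have mZ k : predictable F (Z k).
  apply: predictable_time_index => // n; have [+ _] := HN k => /(_ n).
  by rewrite predictable_timeE.
have mZt k t := predictable_process filtF (mZ k) t.
have Zh k t : (L1dist P (Z k t) (h t) <= (e k)%:E)%E.
  (* Compare with a process of larger index, itself within [eps] of the limit. *)
  apply/lee_addgt0Pr => eps eps0; have [n _ ne] := cY t eps eps0.
  apply: (le_trans (L1dist_triangle P (mZt k t) (mYt (N k t + n)%N t) (mh t))).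
  apply: leeD; last by apply: ne; rewrite /= leq_addl.
  by have [_ /(_ t)/(_ 0%N I)/(_ n I)] := HN k; rewrite /= addn0.
(* Upper limits are measurable without any condition, and [fine] gives the value
   0 where they are infinite. *)
pose Re_ u := fine (limn_esup (fun k => (complex.Re (Z k u.1 u.2))%:E)).
pose Im_ u := fine (limn_esup (fun k => (complex.Im (Z k u.1 u.2))%:E)).
exists (fun t w => Complex (Re_ (t, w)) (Im_ (t, w))).
  have mlim (g : nat -> g_sigma_algebraType rect -> R) :
      (forall k, measurable_fun setT (g k)) ->
      measurable_fun setT (fun u => fine (limn_esup (fun k => (g k u)%:E))).
    move=> mg; apply: measurableT_comp => //.
    by apply: measurable_fun_limn_esup => k; exact/measurable_EFinP.
  apply/measurable_fun_complexP; split.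
    apply: (mlim (fun k u => complex.Re (Z k u.1 u.2))) => k.
    by have /measurable_fun_complexP[] := mZ k.
  apply: (mlim (fun k u => complex.Im (Z k u.1 u.2))) => k.
  by have /measurable_fun_complexP[] := mZ k.
move=> t; have := L1dist_cvg_ae (fun k => mZt k t) (mh t) (Zh ^~ t).
apply: filterS => w cw _ /=; rewrite /Re_ /Im_ /=.
have cRe : (complex.Re (Z k t w))%:E @[k --> \oo] --> (complex.Re (h t w))%:E.
  apply: cvg_EFin; first exact: nearW.
  apply/cvgrPdistC_lt => eps eps0; have /cvgr0_norm_lt /(_ _ eps0) := cw.
  apply: filterS => k; apply: le_lt_trans; rewrite normr_id /=.
  by rewrite -(raddfB (@complex.Re R : Rcomplex R -> R)) normr_Re_le.
have cIm : (complex.Im (Z k t w))%:E @[k --> \oo] --> (complex.Im (h t w))%:E.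
  apply: cvg_EFin; first exact: nearW.
  apply/cvgrPdistC_lt => eps eps0; have /cvgr0_norm_lt /(_ _ eps0) := cw.
  apply: filterS => k; apply: le_lt_trans; rewrite normr_id /=.
  by rewrite -(raddfB (@complex.Im R : Rcomplex R -> R)) normr_Im_le.
rewrite (cvg_limn_einf_sup cRe).2 (cvg_limn_einf_sup cIm).2 /=.
by case: (h t w).
Qed.

End predictable_limit.

(** * Predictable linear processes have predictable modifications *)

Section linear_to_predictable.
Context d (T : measurableType d) (R : realType) (P : probability T R).
Context (p q r : \bar R) (p1 : (1 <= p)%E) (q1 : (1 <= q)%E) (r1 : (1 <= r)%E).
Hypothesis pqr : (r^-1 + p^-1 = q^-1)%E.
Variable F : {nonneg R} -> set (set T).
Hypothesis filtF : filtration F.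
Implicit Types (Y : {nonneg R} -> T -> Rcomplex R).
Local Notation M := (mulops P p1 q1 r1 pqr F).
Local Notation mulop := (mulop p1 q1 pqr).
Local Notation rect := (predictable_rectangle F).
Implicit Types (H K : {nonneg R} -> Bop (Lp P p1) (Lp P q1)).

Definition predictably_represented H := exists2 Y, predictable F Y &
  forall t, exists2 y : Lp P r1, H t = mulop y & repr0 y = Y t %[ae P].

Lemma predictably_representedD H K :
  predictably_represented H -> predictably_represented K ->
  predictably_represented (fun t => H t + K t).
Proof.
move=> [X mX HX] [Y mY KY]; exists (fun t w => X t w + Y t w).
  exact: (measurable_complexD mX mY).
move=> t; have [x Hx xX] := HX t; have [y Ky yY] := KY t; exists (x + y).
  by rewrite Hx Ky mulopD.
apply: filterS2 (filterI xX yY) (repr0D (\val x) (\val y)) => w [h1 h2] h3 _.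
by rewrite h3//= h1// h2.
Qed.

(** Outside S the process vanishes, so the preimage of A is a predictable set
    of the form [S `*` B], together with the complement of [S `*` setT] when A
    contains 0. *)
Lemma predictable_timed (S : set {nonneg R}) s (f : T -> Rcomplex R) :
  (forall A, F s A -> <<s rect >> (S `*` A)) ->
  measurable_fun setT (f : g_sigma_algebraType (F s) -> Rcomplex R) ->
  predictable F (fun t w => \1_S t *: f w).
Proof.
move=> mS mf _ A mA; rewrite setTI.
have mfA : <<s rect >> (S `*` (f @^-1` A)).
  by apply: mS; rewrite -filtration_measurable// -[X in measurable X]setTI; exact: mf.
have mST : <<s rect >> (S `*` setT) by apply: mS; exact: filtrationT.
have [A0|A0] := pselect (A 0).
  rewrite (_ : _ @^-1` _ = (S `*` (f @^-1` A)) `|` ~` (S `*` setT)).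
    apply: (@measurableU _ (g_sigma_algebraType rect)) => //.
    exact: (@measurableC _ (g_sigma_algebraType rect)).
  apply/seteqP; split => -[t w] /=; rewrite indicE.
    by have [/set_mem St|/negP tS] := boolP (t \in S); rewrite ?scale1r; [left|right => -[/mem_set]].
  have [/set_mem St|/negP tS] := boolP (t \in S); rewrite ?scale1r ?scale0r//.
  by case=> [[]//|h]; case: h.
rewrite (_ : _ @^-1` _ = S `*` (f @^-1` A))//.
apply/seteqP; split => -[t w] /=; rewrite indicE.
  by have [/set_mem St|/negP tS] := boolP (t \in S); rewrite ?scale1r ?scale0r.
by case=> /mem_set ->; rewrite scale1r.
Qed.

Lemma predictably_represented_timed (S : set {nonneg R}) s U :
  (forall A, F s A -> <<s rect >> (S `*` A)) -> M s U ->
  predictably_represented (fun t => \1_S t *: U).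
Proof.
move=> mS [y [f mf yf] <-]; exists (fun t w => \1_S t *: f w).
  exact: (predictable_timed mS mf).
move=> t; exists (\1_S t *: y); first by rewrite mulopZ.
apply: filterS2 yf (repr0Z (\1_S t) (\val y)) => w h1 h2 _.
by rewrite h2//= h1.
Qed.

Lemma elementary_predictably_represented H : elementary M H -> predictably_represented H.
Proof.
move=> [k [s [t [T0 [S [st MT0 MS ->]]]]]]; apply: predictably_representedD.
  apply: (predictably_represented_timed (s := 0%:nng)) => // A FA.
  by apply: sub_sigma_algebra; left; exists A.
elim: (index_enum _) => [|i l IHl].
  have := predictably_represented_timed (S := set0) (s := 0%:nng) _ MT0.
  rewrite (_ : (fun _ => _) = (fun u => \sum_(i <- [::]) \1_[set v | s i < v <= t i] u *: S i)).
    by apply => A _; rewrite set0X; exact: sigma_algebra0.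
  by apply/funext => u; rewrite indic0 scale0r big_nil.
rewrite (_ : (fun _ => _) = (fun u => \1_[set v | s i < v <= t i] u *: S i +
    \sum_(i <- l) \1_[set v | s i < v <= t i] u *: S i)); last first.
  by apply/funext => u; rewrite big_cons.
apply: predictably_representedD IHl; apply: (predictably_represented_timed _ (MS i)).
by move=> A FA; apply: sub_sigma_algebra; right; exists (s i), (t i), A.
Qed.

(** The distance in mean is controlled by the operator norm
    ([L1_le_norm_mulop]), which reduces the claim to [predictable_limit]. *)
Lemma predictably_represented_limit (Hn : nat -> {nonneg R} -> Bop (Lp P p1) (Lp P q1)) H :
  (forall n, predictably_represented (Hn n)) ->
  (forall t, (\bigcup_s M s) (H t)) ->
  (forall t, Hn n t @[n --> \oo] --> H t) ->
  predictably_represented H.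
Proof.
move=> rH MH cH.
have /choice[Yn HYn] n : exists Y, predictable F Y /\
    forall t, exists2 y : Lp P r1, Hn n t = mulop y & repr0 y = Y t %[ae P].
  by have [Y mY HY] := rH n; exists Y.
have /choice[h Hh] t : exists y : Lp P r1, H t = mulop y.
  by have [s _ [y _ yE]] := MH t; exists y.
have [|t e e0|Y mY Yh] := predictable_limit filtF (P := P) (h := fun t => repr0 (h t))
    (fun n => (HYn n).1).
- by move=> t; exact: measurable_repr0.
- have /cvgrPdistC_lt /(_ _ e0) := cH t; apply: filterS => n /ltW ne.
  have [_ /(_ t)[y Hy yY]] := HYn n.
  apply: (@le_trans _ _ (\int[P]_w (`|repr0 (- 1 *: h t + y) w|)%:E)%E).
    apply: ae_ge0_le_integral => //.
    + apply: measurable_dist; last exact: measurable_repr0.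
      exact: (predictable_process filtF (HYn n).1).
    + by apply/measurable_EFinP; apply: measurable_complex_norm; exact: measurable_repr0.
    + apply: filterS3 yY (repr0D (-1 *: \val (h t)) (\val y)) (repr0Z (-1) (\val (h t))).
      by move=> w h1 h2 h3 _; rewrite h2//= h3//= h1//= scaleN1r addrC.
  apply: le_trans (L1_le_norm_mulop p1 q1 pqr _) _.
  by rewrite lee_fin mulop_linear scaleN1r addrC -Hy -Hh.
exists Y => // t; exists (h t) => //.
by apply: filterS (Yh t) => w /[apply] ->.
Qed.

Lemma predictable_linear_predictably_represented H :
  predictable_linear M H -> predictably_represented H.
Proof.
move: H; apply: predictable_linear_ind.
- exact: mulops0.
- by move=> *; exact: mulops_linear.
- by move=> *; exact: mulops_mono.
- exact: elementary_predictably_represented.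
- by move=> Hn H _ rH [_ MH] [cH _]; exact: predictably_represented_limit cH.
Qed.

End linear_to_predictable.

Theorem theorem2p42 (R : realType) (d : measure_display)
    (T : measurableType d) (P : probability T R)
    (F : {nonneg R} -> set (set T))
    (p q r : \bar R) (p1 : (1 <= p)%E) (q1 : (1 <= q)%E) (r1 : (1 <= r)%E)
    (qp : (q <= p)%E) (pqr : (r^-1 + p^-1 = q^-1)%E)
    (X : {nonneg R} -> T -> Rcomplex R)
    (mX : stochastic_process X) (bX : Lr_locally_bounded P r X) :
  usual_conditions P F ->
  ((q < p)%E -> has_predictable_modification P F X ->
     predictable_linear (mulops P p1 q1 r1 pqr F)
       (linear_process p1 q1 r1 pqr mX bX)) /\
  (predictable_linear (mulops P p1 q1 r1 pqr F)
     (linear_process p1 q1 r1 pqr mX bX) ->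
   has_predictable_modification P F X).
Proof.
move=> [filtF _ _]; split=> [qltp [Y [mY pY YX]]|].
  have roo : r != +oo%E.
    apply/eqP => rE; move: pqr qltp; rewrite rE invey add0e => /(congr1 inve).
    by rewrite !inveK => ->; rewrite ltxx.
  have LY : Lr_predictable P r F Y.
    split=> // t; apply: le_lt_trans (bX t).
    apply: ge_ereal_sup => _ [s st <-]; apply: ereal_sup_ubound; exists s => //.
    exact: (ae_eq_cLnorm r1 (mX s) (mY s) (YX s)).
  have [_] := predictable_mul_predictable p1 q1 r1 pqr filtF roo LY.
  congr predictable_linear; apply/funext => t; congr mulop.
  apply: Lp_of_eq; apply: filterS2 (YX t) (repr_classLp r1 (mX t) (Lr_locally_bounded_fin bX t)).
  by move=> w h1 h2 _; rewrite h2// h1.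
move=> /predictable_linear_predictably_represented[//|Y pY HY].
exists Y; split => //; first exact: (predictable_process filtF pY).
move=> t; have [y /mulop_inj Xy yY] := HY t.
have := repr_classLp r1 (mX t) (Lr_locally_bounded_fin bX t); rewrite Xy.
by apply: filterS2 yY => w h1 h2 _; rewrite -h2// h1.
Qed.
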